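(* Let $p\ge 1$ be an integer, let $\Sigma$ be a non-singular $(p\times p)$ covariance matrix, and let $\alpha>0$ be real with $2\alpha\in\mathbb{N}\cup\bigl([(p-1)/2],\infty\bigr)$, where $[(p-1)/2]$ is the integer part of $(p-1)/2$. Then the function $g_\alpha(x_1,\dots,x_p;\alpha,\Sigma)$ with Laplace transform $|I_p+\Sigma T|^{-\alpha}$ is a $\Gamma_p(\alpha,\Sigma)$ probability density; that is, there is a probability density $g_\alpha(\cdot\,;\alpha,\Sigma)$ on $(0,\infty)^p$ such that $$\int_{(0,\infty)^p}\exp\Bigl(-\sum_{j=1}^p t_jx_j\Bigr)g_\alpha(x_1,\dots,x_p;\alpha,\Sigma)\,dx_1\cdots dx_p=|I_p+\Sigma T|^{-\alpha}$$ for all $T=\mathrm{diag}(t_1,\dots,t_p)$ with $t_1,\dots,t_p\ge 0$.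
   Context: A non-singular covariance matrix is a real symmetric positive definite matrix; $|A|$ denotes the determinant of $A$; $I_p$ is the $(p\times p)$ identity matrix; $\mathbb{N}=\{1,2,3,\dots\}$. The $p$-variate gamma distribution $\Gamma_p(\alpha,\Sigma)$ (in the sense of Krishnamoorthy and Parthasarathy) with associated covariance matrix $\Sigma$ and degree of freedom $\nu=2\alpha$ is defined as the probability distribution on $(0,\infty)^p$ whose density has the Laplace transform $|I_p+\Sigma T|^{-\alpha}$, $T=\mathrm{diag}(t_1,\dots,t_p)$, $t_j\ge 0$, provided such a probability density exists, i.e. provided the function with this Laplace transform assumes no negative values. *)

(* Defs.v *)
From HB Require Import structures.
From mathcomp Require Import all_boot all_order all_algebra.
From mathcomp Require Import all_classical all_reals all_analysis.

Set Implicit Arguments.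
Unset Strict Implicit.
Unset Printing Implicit Defensive.

Import Order.TTheory GRing.Theory Num.Theory.

Local Open Scope classical_set_scope.
Local Open Scope ring_scope.

Section cons_measure.
Local Open Scope ereal_scope.
Context d (T : measurableType d) (R : realType).
Variable mu : {sigma_finite_measure set T -> \bar R}.
Variable n : nat.
Variable m : {sigma_finite_measure set (n.-tuple T) -> \bar R}.

Definition cons_tuple2 (z : T * n.-tuple T) : n.+1.-tuple T :=
  [tuple of z.1 :: z.2].

Lemma measurable_cons_tuple2 :
  measurable_fun [set: T * n.-tuple T] cons_tuple2.
Proof. exact: measurable_cons. Qed.

(* [mu \x m] transported along [T * T^n = T^(n+1)]; the measure structure is
   on the transport because the canonical sigma-finite structure of [\x] is
   only found when its factors are subprobabilities. *)
Definition cons_measure : set (n.+1.-tuple T) -> \bar R :=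
  pushforward (mu \x m) cons_tuple2.

Let cons_measure0 : cons_measure set0 = 0.
Proof. by rewrite /cons_measure /pushforward preimage_set0 measure0. Qed.

Let cons_measure_ge0 A : 0 <= cons_measure A.
Proof. exact: (measure_ge0 (mu \x m)). Qed.

Let cons_measure_sigma_additive : semi_sigma_additive cons_measure.
Proof.
move=> F mF tF mUF; rewrite /cons_measure /pushforward preimage_bigcup.
apply: measure_semi_sigma_additive.
- by move=> k; rewrite -[X in measurable X]setTI; exact: measurable_cons_tuple2.
- apply/trivIsetP => /= i j _ _ ij; rewrite -preimage_setI.
  by move/trivIsetP : tF => /(_ _ _ _ _ ij) ->//; rewrite preimage_set0.
- rewrite -preimage_bigcup -[X in measurable X]setTI.
  exact: measurable_cons_tuple2.
Qed.

HB.instance Definition _ := isMeasure.Build _ _ _ cons_measure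
  cons_measure0 cons_measure_ge0 cons_measure_sigma_additive.

Lemma measurable_thead_behead (A : set T) (B : set (n.-tuple T)) :
  measurable A -> measurable B ->
  measurable [set t : n.+1.-tuple T | A (thead t) /\ B [tuple of behead t]].
Proof.
move=> mA mB.
rewrite (_ : mkset _ = ((@tnth _ T)^~ ord0 @^-1` A) `&`
    ((fun t : n.+1.-tuple T => [tuple of behead t]) @^-1` B)) //.
apply: measurableI; rewrite -[X in measurable X]setTI.
  exact: measurable_tnth.
exact: measurable_behead.
Qed.

Lemma cons_measureE (A : set T) (B : set (n.-tuple T)) :
  measurable A -> measurable B ->
  cons_measure [set t | A (thead t) /\ B [tuple of behead t]] = mu A * m B.
Proof.
move=> mA mB; rewrite -product_measure1E//.
rewrite /cons_measure /pushforward; apply: congr1.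
apply/seteqP; split => -[x t] /= [Ax Bt]; split => //.
  by rewrite (_ : t = [tuple of behead (cons_tuple2 (x, t))])//; exact: val_inj.
by rewrite (_ : [tuple of _] = t)//; exact: val_inj.
Qed.

Let cons_measure_sigma_finite : sigma_finite setT cons_measure.
Proof.
have /sigma_finiteP[F [TF ndF Foo]] := sigma_finiteT mu.
have /sigma_finiteP[G [TG ndG Goo]] := sigma_finiteT m.
exists (fun k => [set t | F k (thead t) /\ G k [tuple of behead t]]).
  apply/seteqP; split => // t _.
  have [i _ Fi] : (\bigcup_i F i) (thead t) by rewrite -TF.
  have [j _ Gj] : (\bigcup_i G i) [tuple of behead t] by rewrite -TG.
  exists (maxn i j) => //; split.
    by move: Fi; exact/subsetPset/ndF/leq_maxl.
  by move: Gj; exact/subsetPset/ndG/leq_maxr.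
move=> k; have [mF Fk] := Foo k; have [mG Gk] := Goo k.
split; first exact: measurable_thead_behead.
by rewrite cons_measureE// lte_mul_pinfty// ge0_fin_numE.
Qed.

HB.instance Definition _ := Measure_isSigmaFinite.Build _ _ _ cons_measure
  cons_measure_sigma_finite.

End cons_measure.

Section tuple_measure.
Local Open Scope ereal_scope.
Context d (T : measurableType d) (R : realType).
Variable mu : {sigma_finite_measure set T -> \bar R}.

(* The n-fold product measure on the product sigma-algebra of [n.-tuple T],
   characterized on boxes by [tuple_measureE]. *)
Fixpoint tuple_measure n : {sigma_finite_measure set (n.-tuple T) -> \bar R} :=
  match n with
  | 0 => \d_[tuple]
  | n'.+1 => cons_measure mu (tuple_measure n')
  end.

Lemma tuple_measureE n (A : 'I_n -> set T) : (forall i, measurable (A i)) ->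
  tuple_measure n [set t | forall i, A i (tnth t i)] = \prod_(i < n) mu (A i).
Proof.
elim: n A => [|n IHn] A mA /=.
  by rewrite big_ord0 diracE mem_set// => -[].
rewrite big_ord_recl -IHn// -cons_measureE//; last first.
  rewrite (_ : mkset _ =
      \bigcap_(i in [set: 'I_n]) ((@tnth n T)^~ i @^-1` A (lift ord0 i))).
    apply: fin_bigcap_measurable => // i _.
    by rewrite -[X in measurable X]setTI; exact: measurable_tnth.
  by apply/seteqP; split => t /= At i; [move=> _|]; exact: At.
have tnthL (t : n.+1.-tuple T) i :
    tnth t (lift ord0 i) = tnth [tuple of behead t] i.
  by rewrite [in LHS](tuple_eta t) tnthS.
apply: congr1; apply/seteqP; split => t /=.
  by move=> At; split => [|i]; [exact: At|rewrite -tnthL; exact: At].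
move=> [A0 At] i; have [->//|] := eqVneq i ord0.
by rewrite eq_sym => /unlift_some[j -> _]; rewrite tnthL.
Qed.

End tuple_measure.

Section multivariate_gamma.
Context {R : realType}.

Definition lebesgue_tuple n :
    {sigma_finite_measure set (n.-tuple (measurableTypeR R)) -> \bar R} :=
  tuple_measure lebesgue_measure n.

Definition orthant p : set (p.-tuple (measurableTypeR R)) :=
  [set x | forall j, 0 < tnth x j].

Definition is_orthant_pdf p (g : p.-tuple (measurableTypeR R) -> R) :=
  [/\ measurable_fun (@orthant p) g,
      forall x, orthant x -> 0 <= g x
    & (\int[lebesgue_tuple p]_(x in @orthant p) (g x)%:E = 1)%E].

(* Extended-real valued integral, so an equality with a real number includes
   finiteness. *)
Definition laplace p (g : p.-tuple (measurableTypeR R) -> R) (t : 'rV[R]_p) :=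
  (\int[lebesgue_tuple p]_(x in @orthant p)
    (expR (- \sum_(j < p) t ord0 j * tnth x j) * g x)%:E)%E.

Definition is_posdefmx p (A : 'M[R]_p) :=
  A^T = A /\ forall u : 'rV[R]_p, u != 0 -> 0 < (u *m A *m u^T) ord0 ord0.

(* The density of the p-variate gamma distribution in the sense of
   Krishnamoorthy and Parthasarathy. The determinant below is positive when
   [Sigma] is positive definite and [t >= 0], so [powR] is the usual power. *)
Definition is_gamma_pdf p (alpha : R) (Sigma : 'M[R]_p)
    (g : p.-tuple (measurableTypeR R) -> R) :=
  is_orthant_pdf g /\
  forall t : 'rV[R]_p, (forall j, 0 <= t ord0 j) ->
    laplace g t = ((\det (1%:M + Sigma *m diag_mx t)) `^ (- alpha))%:E.

End multivariate_gamma.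

(* Main.v *)
Require Import Defs.
From HB Require Import structures.
From mathcomp Require Import all_boot all_order all_algebra.
From mathcomp Require Import all_classical all_reals all_analysis.
From mathcomp Require Import measurable_realfun.
From mathcomp Require Import zify ring lra.

Set Implicit Arguments.
Unset Strict Implicit.
Unset Printing Implicit Defensive.

Import Order.TTheory GRing.Theory Num.Theory.
Import numFieldNormedType.Exports.

Local Open Scope classical_set_scope.
Local Open Scope ring_scope.

(** Put [Om = Sigma^-1].  Since [det (1 + Sigma T) = det Sigma * det (Om + T)],
    it is enough to obtain a multiple of [det (Om + T)^-a], with [a = alpha], as
    the Laplace transform of a nonnegative function supported by the orthant.
    When [2 a] is an integer, this is the law of the halved squared lengths of
    [p] Gaussian vectors of [R^(2 a)] with covariance [Sigma] between them; for
    real [2 a] there is no such space, but the joint law can be built without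
    it, one vector after the other, because every step only uses the coordinates
    of a vector in finitely many directions and the squared length of its
    remaining component, which is a gamma variable of real shape.

    The induction needs noncentral laws.  For [M] with [n] rows and [q] columns,
    the target is
      [det (Om + T)^-a * exp (tr (M^T (Om + T)^-1 M))],
    where the rows of [M] parametrize the means of [n] vectors and the columns
    are orthonormal directions containing these means.  [has_ncgamma n q a] says
    that for all [Om] this is the transform of a nonnegative function of the
    orthant that depends measurably on [M].

    To split off the first vector, write [Z = Om + T] in blocks
    [(z, b^T; b, Z')] with Schur complement [s = z - b^T Z'^-1 b].  Then
    [det Z = s * det Z'] and [tr (M^T Z^-1 M)] is the corresponding trace for
    [Z'] plus a sum of squares divided by [s] ([det_schur], [trace_form_schur]).
    The first vector has [q] Gaussian coordinates [y] and a rest of squared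
    length [r], of noncentral gamma law with shape [a - q/2 > 0]; given [y] and
    [w = r + |y|^2], the other vectors follow a law of the same family, and
    integrating over [y] and [w] restores the target ([integral_peel]).
    This is used in two ways.
    - If [q < 2 a], the rest of the first vector defines a new direction, so
      [has_ncgamma n (q + 1) a] implies [has_ncgamma (1 + n) q a]
      ([has_ncgamma_new_direction]).
    - If [n <= q < 2 a], a rotation makes one of [q + 1] directions orthogonal
      to all means but the first.  Given the first vector, the others split into
      a component along it, with one degree of freedom, and a component
      orthogonal to it, with [2 a - 1] degrees of freedom, so
      [has_ncgamma n q (a - 1/2)] implies [has_ncgamma (1 + n) (1 + q) a]
      ([has_ncgamma_aligned]).

    With [k = [(p-1)/2] < 2 a], the second rule gives [p - k - 1 <= k + 1] rows
    with [k + 1] directions, and [k + 1] uses of the first rule trade these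
    directions for rows: [has_ncgamma p 0 a].  For integral [2 a], the laws with
    one degree of freedom ([has_ncgamma_half]) are convolved instead. *)

(** * Positive definite matrices and Schur complements *)

Section PosDef.
Context {R : realType}.
Implicit Types (n q : nat).

Lemma posdef_sym n (A : 'M[R]_n) : is_posdefmx A -> A^T = A.
Proof. by case. Qed.

Lemma posdef_unit n (A : 'M[R]_n) : is_posdefmx A -> A \in unitmx.
Proof.
move=> [_ Apos]; rewrite -row_free_unit -kermx_eq0; apply: contraT => kA.
have /rowV0Pn[v /sub_kermxP vA v0] := kA.
by have := Apos v v0; rewrite vA mul0mx mxE ltxx.
Qed.

Lemma posdef_add_diag n (A : 'M[R]_n) (t : 'rV[R]_n) :
  is_posdefmx A -> (forall j, 0 <= t ord0 j) -> is_posdefmx (A + diag_mx t).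
Proof.
move=> [sA Apos] t0; split; first by rewrite linearD /= sA tr_diag_mx.
move=> u u0; rewrite mulmxDr mulmxDl mxE ltr_wpDr ?Apos// mul_mx_diag.
rewrite mxE sumr_ge0// => j _; rewrite !mxE -mulrA mulrCA mulr_ge0 ?t0//.
by rewrite -expr2 sqr_ge0.
Qed.

Lemma posdef_inv n (A : 'M[R]_n) : is_posdefmx A -> is_posdefmx (invmx A).
Proof.
move=> Ap; have uA := posdef_unit Ap; have [sA Apos] := Ap.
split; first by rewrite trmx_inv sA.
move=> u u0; have := Apos (u *m invmx A); rewrite mulmxKV//.
rewrite trmx_mul trmx_inv sA mulmxA; apply.
by apply: contra u0 => /eqP uA0; rewrite -(mulmxKV uA u) uA0 mul0mx.
Qed.

Lemma posdef_drsubmx n (A : 'M[R]_(1 + n)) :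
  is_posdefmx A -> is_posdefmx (drsubmx A).
Proof.
move=> [sA Apos]; split; first by rewrite trmx_drsub sA.
move=> u u0; have := Apos (row_mx 0 u); rewrite -[A in _ *m A *m _]submxK.
rewrite mul_row_block tr_row_mx mul_row_col !mul0mx !add0r trmx0 mulmx0 add0r.
by apply; rewrite row_mx_eq0 negb_and u0 orbT.
Qed.

(** The exponents of the Laplace transforms below are the values
    [trace_form Z M M]; the polarized form serves to expand them when [M] is
    shifted. *)
Definition trace_form n q (Z : 'M[R]_n) (A B : 'M[R]_(n, q)) : R :=
  \tr (A^T *m invmx Z *m B).

Definition schur_compl n (Z : 'M[R]_(1 + n)) : R :=
  Z ord0 ord0 - trace_form (drsubmx Z) (dlsubmx Z) (dlsubmx Z).

Section trace_form.
Variables (n q : nat) (Z : 'M[R]_n).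
Lemma trace_formDl (A B C : 'M[R]_(n, q)) :
  trace_form Z (A + B) C = trace_form Z A C + trace_form Z B C.
Proof. by rewrite /trace_form !linearD /= !mulmxDl linearD. Qed.
Lemma trace_formDr (A B C : 'M[R]_(n, q)) :
  trace_form Z C (A + B) = trace_form Z C A + trace_form Z C B.
Proof. by rewrite /trace_form !mulmxDr linearD. Qed.
Lemma trace_formZl a (A B : 'M[R]_(n, q)) :
  trace_form Z (a *: A) B = a * trace_form Z A B.
Proof. by rewrite /trace_form linearZ /= -!scalemxAl linearZ. Qed.
Lemma trace_formZr a (A B : 'M[R]_(n, q)) :
  trace_form Z A (a *: B) = a * trace_form Z A B.
Proof. by rewrite /trace_form -!scalemxAr linearZ. Qed.
Lemma trace_formC (A B : 'M[R]_(n, q)) : Z^T = Z ->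
  trace_form Z A B = trace_form Z B A.
Proof.
by move=> sZ; rewrite /trace_form -mxtrace_tr !trmx_mul trmxK trmx_inv sZ mulmxA.
Qed.
End trace_form.

Lemma trace_form_row_mx n q1 q2 (Z : 'M[R]_n) (A : 'M[R]_(n, q1)) (B : 'M[R]_(n, q2)) :
  trace_form Z (row_mx A B) (row_mx A B) = trace_form Z A A + trace_form Z B B.
Proof.
rewrite /trace_form tr_row_mx mul_col_mx mul_col_row mxtrace_block//.
Qed.

Lemma trace_form_orthogonal n q (Z : 'M[R]_n) (A : 'M[R]_(n, q)) (Q : 'M[R]_q) :
  Q *m Q^T = 1%:M -> trace_form Z (A *m Q) (A *m Q) = trace_form Z A A.
Proof.
move=> QQ; rewrite /trace_form trmx_mul !mulmxA mxtrace_mulC !mulmxA QQ mul1mx.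
by [].
Qed.

Lemma mx11_dot k (v : 'rV[R]_k) : (v *m v^T) ord0 ord0 = \sum_j v ord0 j ^+ 2.
Proof. by rewrite mxE; apply: eq_bigr => j _; rewrite mxE expr2. Qed.

Lemma trace_dot k (v : 'rV[R]_k) : \tr (v^T *m v) = \sum_j v ord0 j ^+ 2.
Proof. by rewrite mxtrace_mulC trace_mx11 mx11_dot. Qed.

Section block.
Variables (n : nat) (Z : 'M[R]_(1 + n)).
Hypothesis Zpos : is_posdefmx Z.
Let Z' := drsubmx Z.
Let b : 'cV[R]_n := dlsubmx Z.
Let s := schur_compl Z.

Let Z'pos : is_posdefmx Z'. Proof. exact: posdef_drsubmx. Qed.
Let uZ' := posdef_unit Z'pos.

Let ZE : Z = block_mx (Z ord0 ord0)%:M b^T b Z'.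
Proof.
rewrite -[LHS]submxK; congr block_mx.
- by apply/matrixP => i j; rewrite !ord1 !mxE/=; congr (Z _ _); apply/val_inj.
- by rewrite trmx_dlsub (posdef_sym Zpos).
Qed.

Let bE : b^T *m invmx Z' *m b = (trace_form Z' b b)%:M.
Proof. by rewrite /trace_form trace_mx11; exact: mx11_scalar. Qed.

Let fact : Z = block_mx s%:M b^T 0 Z' *m block_mx 1%:M 0 (invmx Z' *m b) 1%:M.
Proof.
rewrite mulmx_block !mulmx1 !mulmx0 !add0r mulmxA mulKVmx//.
rewrite [LHS]ZE; congr block_mx.
by rewrite bE -raddfD/= /s /schur_compl subrK.
Qed.

Lemma det_schur : \det Z = s * \det Z'.
Proof.
rewrite [in LHS]fact det_mulmx det_ublock det_lblock !det1 !mulr1.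
by rewrite det_scalar1.
Qed.

Lemma schur_compl_gt0 : 0 < s.
Proof.
have [_ /(_ (row_mx 1%:M (- (b^T *m invmx Z'))))] := Zpos.
rewrite [X in _ *m X *m _]fact mulmxA mul_row_block.
rewrite mul1mx mulmx0 addr0 mul1mx mulNmx mulmxKV// addrN.
rewrite mul_row_block mulmx1 !mul0mx mulmx0 !addr0.
rewrite tr_row_mx mul_row_col mul0mx addr0 trmx1 mulmx1 mxE mulr1n; apply.
by rewrite row_mx_eq0 negb_and matrix_nonzero1.
Qed.

(** Block elimination in [Z X = M]: the first row of [X] is the residual
    [m - b^T Z'^-1 M'] divided by the Schur complement. *)
Lemma trace_form_schur q (M : 'M[R]_(1 + n, q)) :
  trace_form Z M M =
  s^-1 * (\sum_j (usubmx M - b^T *m invmx Z' *m dsubmx M) ord0 j ^+ 2)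
    + trace_form Z' (dsubmx M) (dsubmx M).
Proof.
set m := usubmx M; set M' := dsubmx M.
have s0 : s != 0 by rewrite gt_eqF// schur_compl_gt0.
set v := m - _.
pose X0 := s^-1 *: v.
pose X' := invmx Z' *m (M' - b *m X0).
(* [X0] and [X'] are the blocks of [Z^-1 M]. *)
have ZX : Z *m col_mx X0 X' = M.
  rewrite ZE mul_block_col -[RHS]vsubmxK -/m -/M'; congr col_mx.
    rewrite /X' !mulmxA mulmxBr mulmxA.
    rewrite bE !mul_scalar_mx addrCA -scalerBl -/(schur_compl Z) -/s.
    by rewrite /X0 scalerA mulfV// scale1r /v addrC subrK.
  by rewrite /X' mulmxA mulmxV// mul1mx addrC subrK.
have uZ := posdef_unit Zpos.
rewrite {1}/trace_form -mulmxA (_ : invmx Z *m M = col_mx X0 X'); last first.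
  by rewrite -ZX mulKmx.
rewrite -[M in M^T]vsubmxK tr_col_mx mul_row_col -/m -/M' linearD/=.
have -> : M'^T *m X' = M'^T *m invmx Z' *m M' - M'^T *m invmx Z' *m b *m X0.
  by rewrite /X' !mulmxA mulmxBr !mulmxA.
rewrite linearB/= -/(trace_form Z' M' M') addrCA addrC; congr (_ + _).
rewrite -linearB/= -mulmxBl /X0 -scalemxAr linearZ/=; congr (_ * _).
rewrite -trace_dot; congr (\tr (_ *m v)).
rewrite /v linearB/= !trmx_mul trmx_inv trmxK (posdef_sym Z'pos).
by rewrite mulmxA.
Qed.

End block.

Lemma posdef_det n (A : 'M[R]_n) : is_posdefmx A -> 0 < \det A.
Proof.
elim: n A => [|n IHn] A Ap; first by rewrite det_mx00.
by rewrite (det_schur Ap) mulr_gt0 ?(schur_compl_gt0 Ap)// IHn//; exact: posdef_drsubmx.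
Qed.

End PosDef.

(** * Integration over tuples of reals *)

Section Integrals.
Context {R : realType}.
Notation mT := (measurableTypeR R).
Notation leb := (@lebesgue_measure R).
Notation tup n := (n.-tuple mT).

Lemma integral_tuple0 (f : tup 0 -> \bar R) :
  measurable_fun [set: tup 0] f ->
  (\int[lebesgue_tuple 0]_x f x = f [tuple])%E.
Proof.
move=> mf; rewrite /lebesgue_tuple /= integral_dirac//.
by rewrite diracT mul1e.
Qed.

Lemma measurable_tuple_cons n (x : mT) :
  measurable_fun setT (fun t : tup n => [tuple of x :: t] : tup n.+1).
Proof. exact: measurable_cons. Qed.

Lemma integral_tupleS n (f : tup n.+1 -> \bar R) :
  measurable_fun [set: tup n.+1] f -> (forall x, 0 <= f x)%E ->
  (\int[lebesgue_tuple n.+1]_x f x =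
   \int[leb]_x \int[lebesgue_tuple n]_t f [tuple of x :: t])%E.
Proof.
move=> mf f0.
have mc := @measurable_cons_tuple2 _ mT n.
rewrite -[LHS]/(\int[pushforward (leb \x lebesgue_tuple n)%E
   (@cons_tuple2 _ mT n)]_x f x)%E.
rewrite ge0_integral_pushforward//.
rewrite preimage_setT (fubini_tonelli1 (f \o @cons_tuple2 _ mT n))//.
  exact: measurableT_comp.
by move=> x; exact: f0.
Qed.

(** Lebesgue measure and [a] times its image under [x |-> a x + b] agree on
    intervals, hence on all Borel sets. *)
Lemma integral_affine (a b : R) (f : mT -> \bar R) : 0 < a ->
  measurable_fun setT f -> (forall x, 0 <= f x)%E ->
  (\int[leb]_x f (a * x + b)%R = a^-1%:E * \int[leb]_x f x)%E.
Proof.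
move=> a0 mf f0.
pose phi (x : mT) : mT := a * x + b.
have mphi : measurable_fun setT phi.
  by apply: measurable_funD => //; exact: measurable_funM.
have ai0 : 0 <= a by exact: ltW.
have muE A : measurable A ->
    leb A = mscale (NngNum ai0) (pushforward leb phi) A.
  apply: lebesgue_measure_unique => _ [[c d]] _ <- /=.
  rewrite /mscale /= /pushforward.
  rewrite (_ : phi @^-1` _ = `](c - b) / a, (d - b) / a]%classic); last first.
    apply/seteqP; split => x /=; rewrite !in_itv/= ltr_pdivrMr// ler_pdivlMr//;
    by rewrite /phi ltrBlDr lerBrDr mulrC.
  rewrite !lebesgue_measure_itv/= !lte_fin ltr_pM2r ?invr_gt0// ltrD2r.
  case: ifPn => _; last by rewrite mule0.
  rewrite -!EFinD -EFinM; congr EFin; field.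
  by rewrite gt_eqF.
have -> : (\int[leb]_x f x =
    \int[mscale (NngNum ai0) (pushforward leb phi)]_x f x)%E.
  by move=> pm; apply: eq_measure_integral => A mA _; exact: (muE pm).
rewrite ge0_integral_mscale//= ge0_integral_pushforward//.
rewrite muleA -EFinM mulVf ?gt_eqF// mul1e.
by rewrite preimage_setT.
Qed.

Lemma integral_translation (b : R) (f : mT -> \bar R) :
  measurable_fun setT f -> (forall x, 0 <= f x)%E ->
  (\int[leb]_x f (x + b)%R = \int[leb]_x f x)%E.
Proof.
move=> mf f0; have := @integral_affine 1 b f ltr01 mf f0.
by rewrite invr1 mul1e; under eq_integral do rewrite mul1r.
Qed.

Definition tuple_sub n (x y : tup n) : tup n :=
  [tuple tnth x i - tnth y i | i < n].

Lemma tnth_cons0 n (a : mT) (x : tup n) : tnth [tuple of a :: x] ord0 = a.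
Proof. by []. Qed.
Lemma tnth_consS n (a : mT) (x : tup n) i :
  tnth [tuple of a :: x] (lift ord0 i) = tnth x i.
Proof. by rewrite tnthS. Qed.

Lemma tuple_sub_cons n (a b : mT) (x y : tup n) :
  tuple_sub [tuple of a :: x] [tuple of b :: y] = [tuple of (a - b) :: tuple_sub x y].
Proof.
apply: eq_from_tnth => i; rewrite tnth_mktuple.
have [->|] := eqVneq i ord0; first by rewrite !tnth_cons0.
rewrite eq_sym => /unlift_some[j -> _].
by rewrite !tnth_consS tnth_mktuple.
Qed.

Lemma measurable_tuple_sub d (X : measurableType d) n (x y : X -> tup n) :
  measurable_fun setT x -> measurable_fun setT y ->
  measurable_fun setT (fun w => tuple_sub (x w) (y w)).
Proof.
move=> mx my; apply/measurable_fun_tnthP => i.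
rewrite (_ : _ \o _ = (fun w => tnth (x w) i - tnth (y w) i)); last first.
  by apply/funext => w /=; rewrite tnth_mktuple.
apply: measurable_funB.
  exact: (measurableT_comp (measurable_tnth _) mx).
exact: (measurableT_comp (measurable_tnth _) my).
Qed.

Lemma integral_tuple_sub n (y : tup n) (f : tup n -> \bar R) :
  measurable_fun setT f -> (forall x, 0 <= f x)%E ->
  (\int[lebesgue_tuple n]_x f (tuple_sub x y) = \int[lebesgue_tuple n]_x f x)%E.
Proof.
elim: n y f => [|n IHn] y f mf f0.
  by apply: eq_integral => x _; rewrite [x]tuple0 [tuple_sub _ _]tuple0.
rewrite !integral_tupleS//; last first.
  apply: (measurableT_comp mf); apply: measurable_tuple_sub => //.
rewrite [y]tuple_eta.
under eq_integral => x _.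
  under eq_integral do rewrite tuple_sub_cons.
  rewrite (IHn _ (fun t => f [tuple of (x - thead y) :: t]))//; last first.
    exact: (measurableT_comp mf (measurable_tuple_cons _)).
  over.
rewrite (integral_translation (- thead y)
  (f := fun x => \int[lebesgue_tuple n]_t f [tuple of x :: t])%E)//.
  apply: (measurable_fun_fubini_tonelli_F (f \o @cons_tuple2 _ mT n)) => //=.
  exact: (measurableT_comp mf (@measurable_cons_tuple2 _ mT n)).
by move=> x; apply: integral_ge0.
Qed.

End Integrals.

(** * Measurable real functions and Gaussian integrals *)

Section MeasurableReal.
Context {R : realType} d (X : measurableType d).
Implicit Types f g : X -> R.

(** [x^-1 = x * (x^2)^-1] also holds at [0], where inversion is not continuous,
    and reduces inversion to a real power of a nonnegative number. *)
Lemma measurable_funV f : measurable_fun [set: X] f ->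
  measurable_fun [set: X] (fun w => (f w)^-1).
Proof.
move=> mf; rewrite (_ : (fun _ => _) = fun w => f w * (f w ^+ 2) `^ (-1)).
  apply: measurable_funM => //.
  exact: (measurableT_comp (measurable_powR _) (measurable_funX _ mf)).
apply/funext => w; rewrite powR_inv1 ?sqr_ge0//.
have [->|f0] := eqVneq (f w) 0; first by rewrite invr0 mul0r.
by rewrite expr2 invfM mulrA mulfV// mul1r.
Qed.

Lemma measurable_fun_expR f : measurable_fun [set: X] f ->
  measurable_fun [set: X] (fun w => expR (f w)).
Proof. exact: (measurableT_comp (@measurable_expR R)). Qed.

Lemma measurable_fun_powR p f : measurable_fun [set: X] f ->
  measurable_fun [set: X] (fun w => f w `^ p).
Proof. exact: (measurableT_comp (measurable_powR p)). Qed.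

Lemma measurable_fun_sqrt f : measurable_fun [set: X] f ->
  measurable_fun [set: X] (fun w => Num.sqrt (f w)).
Proof.
apply: measurableT_comp; apply: continuous_measurable_fun.
exact: sqrt_continuous.
Qed.

End MeasurableReal.

Ltac measR := repeat first
  [ assumption
  | exact: measurable_cst
  | exact: measurable_id
  | apply: measurable_funD
  | apply: measurable_funB
  | apply: measurable_funN
  | apply: measurable_funM
  | apply: measurable_funX
  | apply: measurable_funV
  | apply: measurable_fun_expR
  | apply: measurable_fun_powR
  | apply: measurable_fun_sqrt
  | apply: measurable_sum => ? ].

Section OneDim.
Context {R : realType}.
Notation mT := (measurableTypeR R).
Notation leb := (@lebesgue_measure R).
Notation tup n := (n.-tuple mT).

Lemma integral_gauss_linear (s mu : R) : 0 < s ->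
  (\int[leb]_x (expR (- s * x ^+ 2 + 2 * mu * x))%:E =
   (Num.sqrt pi / Num.sqrt s * expR (mu ^+ 2 / s))%:E)%E.
Proof.
move=> s0; have rs0 : 0 < Num.sqrt s by rewrite sqrtr_gt0.
have mg : measurable_fun [set: mT] (fun x : mT => (gauss_fun x)%:E).
  by apply/measurable_EFinP; rewrite /gauss_fun; measR.
transitivity (\int[leb]_x ((expR (mu ^+ 2 / s))%:E *
    (gauss_fun (Num.sqrt s * x + (- mu / Num.sqrt s)))%:E))%E.
  apply: eq_integral => x _; rewrite -EFinM /gauss_fun -expRD; congr (expR _)%:E.
  have -> : s = Num.sqrt s ^+ 2 by rewrite sqr_sqrtr// ltW.
  by rewrite sqrtr_sqr ger0_norm ?ltW//; field; rewrite gt_eqF.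
rewrite ge0_integralZl//; last 2 first.
- by apply/measurable_EFinP; rewrite /gauss_fun; measR.
- by move=> x _; rewrite lee_fin gauss_fun_ge0.
rewrite (@integral_affine R _ _ (fun x => (gauss_fun x)%:E))//; last first.
  by move=> x; rewrite lee_fin gauss_fun_ge0.
rewrite integralT_gauss -!EFinM; congr EFin.
by rewrite mulrC (mulrC _^-1).
Qed.

Lemma integral_gauss_tuple q (s : R) (mu : 'I_q -> R) : 0 < s ->
  (\int[lebesgue_tuple q]_x
     (expR (- s * \sum_j tnth x j ^+ 2 + 2 * \sum_j mu j * tnth x j))%:E =
   ((Num.sqrt pi / Num.sqrt s) ^+ q * expR ((\sum_j mu j ^+ 2) / s))%:E)%E.
Proof.
move=> s0; elim: q mu => [|q IHq] mu.
  rewrite integral_tuple0; last first.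
    by apply/measurable_EFinP; measR; exact: measurable_tnth.
  by rewrite !big_ord0 mul0r !mulr0 addr0 expr0 mul1r.
rewrite integral_tupleS; last 2 first.
- apply/measurable_EFinP; measR; exact: measurable_tnth.
- by move=> x; rewrite lee_fin expR_ge0.
transitivity (\int[leb]_x ((expR (- s * x ^+ 2 + 2 * mu ord0 * x))%:E *
   ((Num.sqrt pi / Num.sqrt s) ^+ q *
     expR ((\sum_j mu (lift ord0 j) ^+ 2) / s))%:E))%E.
  apply: eq_integral => x _; rewrite -(IHq (fun j => mu (lift ord0 j))).
  rewrite -ge0_integralZl//; last first.
    by apply/measurable_EFinP; measR; exact: measurable_tnth.
  apply: eq_integral => y _; rewrite -EFinM -expRD !big_ord_recl.
  congr (expR _)%:E.
  under eq_bigr do rewrite tnth_consS.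
  under [in X in _ + 2 * X]eq_bigr do rewrite tnth_consS.
  rewrite !tnth_cons0; set a := \sum_(i < q) tnth y i ^+ 2.
  set c := \sum_(i < q) mu (lift ord0 i) * tnth y i.
  move: (mu ord0) => m0; ring.
rewrite ge0_integralZr//; last first.
  by apply/measurable_EFinP; measR.
rewrite integral_gauss_linear// -EFinM big_ord_recl mulrDl expRD.
set A := expR _; set B := expR _; set C := (_ / _)%R; congr EFin.
by rewrite mulrACA -exprS.
Qed.

End OneDim.

(** * The Gamma integral *)

Section GammaIntegral.
Context {R : realType}.
Notation mT := (measurableTypeR R).
Notation leb := (@lebesgue_measure R).

(** To bound the Gamma integral at both ends of the half-line at once, it is
    compared with the beta prime density [f x = x^(c-1) / (1+x)^(c+1)], which
    has the bounded antiderivative [F x = (x / (1+x))^c / c]. *)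
Section beta_prime.
Variables (c : R) (c0 : 0 < c).

Let F (x : R) := expR (c * (ln x - ln (x + 1))) / c.
Let f (x : R) := expR (c * (ln x - ln (x + 1))) * (x^-1 - (x + 1)^-1).

Let dF (x : R) : 0 < x -> is_derive x 1 F (f x).
Proof.
move=> x0.
have x10 : 0 < x + 1 by rewrite addr_gt0.
have dl := is_derive1_ln x0.
have dx1 : is_derive x 1 (shift (1:R)) 1.
  exact: is_derive_shift.
have dl1 : is_derive x 1 (@ln R \o (shift (1:R))) ((x + 1)^-1 * 1).
  by apply: is_derive1_comp; exact: is_derive1_ln.
pose g := (c *: (@ln R - (@ln R \o (shift (1:R))))).
have dg : is_derive x 1 g (c * (x^-1 - (x + 1)^-1)).
  by apply: is_derive_eq; rewrite mulr1.
have -> : F = (c^-1 *: (@expR R \o g)).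
  by apply/funext => y; rewrite /F mulrC.
have de : is_derive x 1 (@expR R \o g) (expR (g x) * (c * (x^-1 - (x + 1)^-1))).
  exact: is_derive1_comp.
apply: is_derive_eq.
by rewrite /GRing.scale/= mulrCA mulKf ?gt_eqF.
Qed.

Let cF (x : R) : 0 < x -> {for x, continuous F}.
Proof.
move=> x0; apply/differentiable_continuous/derivable1_diffP.
by have [] := dF x0.
Qed.

Let cf (x : R) : 0 < x -> {for x, continuous f}.
Proof.
move=> x0; have x10 : 0 < x + 1 by rewrite addr_gt0.
have cs : {for x, continuous (shift (1 : R))}.
  apply/differentiable_continuous/derivable1_diffP.
  by have [] := is_derive_shift x 1 (1 : R).
apply: (@continuousM _ _ (fun y => expR (c * (ln y - ln (y + 1))))
  (fun y => y^-1 - (y + 1)^-1)).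
  apply: continuous_comp; last exact: continuous_expR.
  apply: (@continuousM _ _ (cst c) (fun y => ln y - ln (y + 1))).
    exact: cst_continuous.
  apply: (@continuousB _ _ _ (@ln R) (@ln R \o shift 1)).
    exact: continuous_ln.
  by apply: continuous_comp; [exact: cs|exact: continuous_ln].
apply: (@continuousB _ _ _ (fun y : R => y^-1) (fun y : R => (y + 1)^-1)).
  by apply: (@continuousV _ _ (fun y => y)); [rewrite gt_eqF|exact: cvg_id].
by apply: (@continuousV _ _ (fun y : R => y + 1)); [rewrite gt_eqF|exact: cs].
Qed.

Let f_ge0 (x : R) : 0 < x -> 0 <= f x.
Proof.
move=> x0; rewrite mulr_ge0 ?expR_ge0// subr_ge0 lef_pV2 ?posrE ?addr_gt0//.
by rewrite lerDl.
Qed.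

Let int_f_itv (a b : R) : 0 < a -> a < b ->
  (\int[leb]_(x in `[a, b]) (f x)%:E <= (c^-1)%:E)%E.
Proof.
move=> a0 ab; rewrite (@continuous_FTC2 _ _ F)//.
- rewrite -EFinB lee_fin lerBlDr -[leLHS]addr0 lerD//; last first.
    by rewrite /F divr_ge0 ?expR_ge0 ?ltW.
  have b0 : 0 < b by exact: lt_trans ab.
  rewrite /F -[leRHS]mul1r ler_wpM2r ?invr_ge0 ?ltW// -expR0 ltr_expR.
  by rewrite pmulr_rlt0// subr_lt0 ltr_ln ?posrE ?addr_gt0// ltrDl.
- apply: continuous_in_subspaceT => x; rewrite inE/= in_itv/= => /andP[ax _].
  exact/cf/(lt_le_trans a0).
- split.
  + move=> x; rewrite in_itv/= => /andP[ax _].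
    by have [] := dF (lt_trans a0 ax).
  + exact/cvg_at_right_filter/cF.
  + exact/cvg_at_left_filter/cF/(lt_trans a0).
- move=> x; rewrite in_itv/= => /andP[ax _].
  by rewrite derive1E; have [_ ->] := dF (lt_trans a0 ax).
Qed.

Lemma beta_prime_finite :
  (\int[leb]_(x in `]0%R, +oo[) (expR (c * (ln x - ln (x + 1)))
     * (x^-1 - (x + 1)^-1))%:E <= (c^-1)%:E)%E.
Proof.
(* [n.+2] rather than [n.+1], to avoid the degenerate interval [1, 1]. *)
pose U (n : nat) : set mT := [set` `[n.+2%:R^-1, n.+2%:R]].
have UE : [set` `]0, +oo[] = \bigcup_n U n.
  apply/seteqP; split => [x/=|x [n _]]/=; rewrite !in_itv/= ?andbT.
    move=> x0; pose y := Num.max x x^-1.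
    have y0 : 0 <= y by rewrite le_max (ltW x0).
    have := archi_boundP y0; set n := Num.bound y => yn.
    have {}yn : y <= n.+2%:R.
      by rewrite (le_trans (ltW yn))// ler_nat -addn2 leq_addr.
    exists n => //; rewrite /U/= in_itv/=; move: yn; rewrite ge_max => /andP[xn xVn].
    by rewrite xn andbT -[leRHS]invrK lef_pV2 ?posrE ?invr_gt0.
  by rewrite /U/= ?in_itv/= => /andP[+ _]; apply: lt_le_trans; rewrite invr_gt0.
have U0 n x : U n x -> 0 < x.
  by rewrite /U/= in_itv/= => /andP[+ _]; apply: lt_le_trans; rewrite invr_gt0.
have ndU : nondecreasing_seq U.
  move=> m n mn; apply/subsetPset => x; rewrite /U/= !in_itv/= => /andP[xm mx].
  have le_mn : m.+2%:R <= n.+2%:R :> R by rewrite ler_nat !ltnS.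
  by rewrite (le_trans mx)// andbT (le_trans _ xm)// lef_pV2 ?posrE.
have mf : measurable_fun [set: mT] f.
  rewrite /f; measR; first exact: measurable_ln.
  by apply: (measurableT_comp (@measurable_ln R)); measR.
have mU i : measurable (U i) by exact: measurable_itv.
have mfU i : measurable_fun (U i) (EFin \o f).
  by apply/measurable_EFinP; exact: measurable_funTS.
have fU i x : U i x -> (0 <= (EFin \o f) x)%E.
  by move=> /U0 /f_ge0; rewrite lee_fin.
rewrite UE -(cvg_lim _ (ge0_nondecreasing_set_cvg_integral (mu := leb) ndU mU mfU fU))//.
apply: lime_le.
  apply: ereal_nondecreasing_is_cvgn.
  exact: ge0_nondecreasing_set_nondecreasing_integral.
apply: nearW => n; apply: int_f_itv => //.
by rewrite (@lt_trans _ _ 1)// ?invf_lt1// ltr1n.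
Qed.

End beta_prime.
End GammaIntegral.

Section GammaKernel.
Context {R : realType}.
Notation mT := (measurableTypeR R).
Notation leb := (@lebesgue_measure R).

(** Being [0] on the negative half-line turns integrals over the half-line into
    integrals over the line, which scalings and translations preserve. *)
Definition powRpos (c x : R) : R := if 0 < x then x `^ (c - 1) else 0.

Lemma powRpos_ge0 c x : 0 <= powRpos c x.
Proof. by rewrite /powRpos; case: ifP => // _; rewrite powR_ge0. Qed.

Lemma measurable_powRpos d (X : measurableType d) c (f : X -> R) :
  measurable_fun [set: X] f -> measurable_fun [set: X] (fun w => powRpos c (f w)).
Proof.
move=> mf; apply: measurable_fun_ifT => //.
- by apply: measurable_fun_ltr.
- exact: measurable_fun_powR.
Qed.

Lemma powRpos_scale c s x : 0 < s -> powRpos c (s * x) = s `^ (c - 1) * powRpos c x.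
Proof.
move=> s0; rewrite /powRpos pmulr_rgt0//; case: ifPn => x0; last by rewrite mulr0.
by rewrite powRM// ltW.
Qed.

Definition gamma_integral (c : R) : \bar R :=
  (\int[leb]_x (powRpos c x * expR (- x))%:E)%E.

Definition gamma_fun (c : R) : R := fine (gamma_integral c).

Let restrT (A : set mT) (f : mT -> \bar R) : measurable A ->
  measurable_fun setT f -> measurable_fun setT (f \_ A).
Proof.
move=> mA mf; apply: (measurable_restrictT f mA).1.
exact: measurable_funTS.
Qed.

Let ln_le (y a : R) : 0 < y -> 0 < a -> ln y <= y / a + ln a - 1.
Proof.
move=> y0 a0; have ya0 : 0 < y / a by rewrite divr_gt0.
have := expR_ge1Dx (ln (y / a)); rewrite lnK ?posrE// ln_div ?posrE//.
lra.
Qed.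

Lemma powRposE c (x : R) : 0 < x -> powRpos c x = expR ((c - 1) * ln x).
Proof. by move=> x0; rewrite /powRpos x0 /powR gt_eqF. Qed.

Lemma gamma_integrand_ge0 c (s x : R) : 0 <= powRpos c x * expR (s * x).
Proof. by rewrite mulr_ge0 ?powRpos_ge0 ?expR_ge0. Qed.

Lemma measurable_gamma_integrand c s :
  measurable_fun [set: mT] (fun x : mT => (powRpos c x * expR (s * x))%:E).
Proof. by apply/measurable_EFinP; measR; exact: measurable_powRpos. Qed.

(** [exp (-x) <= K / (1+x)^(c+1)], because [ln (1+x)] lies below its tangent at
    [1 + x = c + 1]; hence the integrand is at most [K] times the beta prime
    density. *)
Lemma gamma_integral_lty (c : R) : 0 < c -> (gamma_integral c < +oo)%E.
Proof.
move=> c0; have c10 : 0 < c + 1 by rewrite addr_gt0.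
pose K := expR (1 + (c + 1) * (ln (c + 1) - 1)).
pose f (x : R) := expR (c * (ln x - ln (x + 1))) * (x^-1 - (x + 1)^-1).
have f0 (x : R) : 0 < x -> 0 <= f x.
  move=> x0; rewrite mulr_ge0 ?expR_ge0// subr_ge0 lef_pV2 ?posrE ?addr_gt0//.
  by rewrite lerDl.
have mf : measurable_fun [set: mT] f.
  rewrite /f; measR; first exact: measurable_ln.
  by apply: (measurableT_comp (@measurable_ln R)); measR.
have mD : measurable [set` `]0%R, +oo[%R : interval R] by exact: measurable_itv.
have := @beta_prime_finite R c c0; rewrite -/f => bfin.
apply: (@le_lt_trans _ _ (K%:E * \int[leb]_(x in `]0%R, +oo[) (f x)%:E)%E);
  last first.
  apply: (@le_lt_trans _ _ (K%:E * (c^-1)%:E)%E); last by rewrite ltry.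
  by rewrite lee_pmul2l// lte_fin expR_gt0.
rewrite -ge0_integralZl//; last 3 first.
- by apply/measurable_EFinP; exact: measurable_funTS.
- by move=> x /=; rewrite in_itv/= andbT lee_fin; exact: f0.
- by rewrite lee_fin expR_ge0.
rewrite /gamma_integral [leRHS]integral_mkcond; apply: ge0_le_integral => //.
- by move=> x _; rewrite lee_fin -mulN1r gamma_integrand_ge0.
- under eq_fun do rewrite -mulN1r; exact: measurable_gamma_integrand.
- apply: restrT; first exact: measurable_itv.
  by apply/measurable_EFinP; measR.
- move=> x _; rewrite patchE mem_setE in_itv/= andbT.
  case: ifPn => x0; last by rewrite /powRpos (negbTE x0) mul0r.
  have x10 : 0 < x + 1 by rewrite addr_gt0.
  rewrite powRposE// -EFinM lee_fin /K /f.
  have -> : x^-1 - (x + 1)^-1 = expR (- ln x - ln (x + 1)).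
    rewrite expRD !expRN !lnK ?posrE//; field.
    by rewrite !gt_eqF.
  rewrite -!expRD ler_expR.
  have := ln_le x10 c10.
  rewrite -(ler_pM2l c10).
  have -> : (c + 1) * ((x + 1) / (c + 1) + ln (c + 1) - 1) =
            (x + 1) + (c + 1) * (ln (c + 1) - 1) by field; rewrite gt_eqF.
  lra.
Qed.

Lemma gamma_integral_gt0 (c : R) : (0 < gamma_integral c)%E.
Proof.
(* On [1, 2], where [0 <= ln x <= 1], the integrand is at least [k]. *)
pose k := expR (- `|c - 1| - 2).
apply: (@lt_le_trans _ _ (\int[leb]_(x in `[1%R, 2%R]) (k%:E))%E).
  rewrite integral_cst ?measurable_itv//= lebesgue_measure_itv/= lte_fin ltr1n.
  by rewrite -EFinB -EFinM lte_fin mulr_gt0 ?expR_gt0// subr_gt0 ltr1n.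
rewrite integral_mkcond; apply: ge0_le_integral => //.
- by move=> x _; apply: erestrict_ge0 => y _; rewrite lee_fin expR_ge0.
- by apply: restrT; first exact: measurable_itv.
- by under eq_fun do rewrite -mulN1r; exact: measurable_gamma_integrand.
- move=> x _; rewrite patchE mem_setE in_itv/=.
  case: ifPn => [/andP[x1 x2]|_]; last first.
    by rewrite lee_fin -mulN1r gamma_integrand_ge0.
  have x0 : 0 < x by rewrite (lt_le_trans _ x1).
  rewrite lee_fin powRposE// -expRD ler_expR lerD//; last by rewrite lerN2.
  have lx0 : 0 <= ln x by rewrite ln_ge0.
  have lx1 : ln x <= 1.
    by have := expR_ge1Dx (ln x); rewrite lnK ?posrE//; lra.
  rewrite lerNl -mulNr (le_trans (ler_norm _))// normrM normrN (ger0_norm lx0).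
  by rewrite ler_piMr.
Qed.

Lemma gamma_integralE (c : R) : 0 < c -> gamma_integral c = (gamma_fun c)%:E.
Proof.
move=> c0; rewrite /gamma_fun fineK// ge0_fin_numE ?gamma_integral_lty//.
by rewrite ltW ?gamma_integral_gt0.
Qed.

Lemma gamma_fun_gt0 (c : R) : 0 < c -> 0 < gamma_fun c.
Proof. by move=> c0; rewrite -lte_fin -gamma_integralE ?gamma_integral_gt0. Qed.

Lemma integral_gamma (c s : R) : 0 < c -> 0 < s ->
  (\int[leb]_x (powRpos c x * expR (- s * x))%:E = (s `^ (- c) * gamma_fun c)%:E)%E.
Proof.
move=> c0 s0.
transitivity (\int[leb]_x ((s `^ (1 - c))%:E *
   (powRpos c (s * x + 0) * expR (- 1 * (s * x + 0)))%:E))%E.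
  apply: eq_integral => x _; rewrite -EFinM addr0 powRpos_scale// !mulrA.
  rewrite -powRD ?(gt_eqF s0) ?implybT// (_ : 1 - c + (c - 1) = 0); last by ring.
  by rewrite powRr0 mul1r mulN1r mulNr.
have m0 := measurable_gamma_integrand c (- 1).
rewrite ge0_integralZl//; last 3 first.
- by apply/measurable_EFinP; measR; apply: measurable_powRpos; measR.
- by move=> x _; rewrite lee_fin gamma_integrand_ge0.
- by rewrite lee_fin powR_ge0.
rewrite (@integral_affine R s 0 (fun x => (powRpos c x * expR (- 1 * x))%:E))//;
  last by move=> x; rewrite lee_fin gamma_integrand_ge0.
under eq_integral do rewrite mulN1r.
rewrite -/(gamma_integral c) gamma_integralE// -!EFinM mulrA; congr (_ * _)%:E.
rewrite -powR_inv1 ?ltW// -powRD ?(gt_eqF s0) ?implybT//.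
by congr (_ `^ _); ring.
Qed.

Lemma nneseries_expR (x : R) : 0 <= x ->
  (\sum_(0 <= k <oo) (x ^+ k / k`!%:R)%:E = (expR x)%:E)%E.
Proof.
move=> x0; rewrite /expR -EFin_lim; last exact: is_cvg_series_exp_coeff.
by congr (limn _); apply/funext => n; rewrite /series/= sumEFin.
Qed.

(** * Gamma kernels on the half-line *)

(** Without the factors [exp (-r)] and [exp (- dl^2)], the density of a
    noncentral gamma law, that is, of a Poisson mixture of gamma laws of shapes
    [c + k].  It is meant as the law of a squared length [r] in dimension [2 c]
    with a mean of length proportional to [dl]. *)
Definition ncgamma_kernel (c dl r : R) : \bar R :=
  (\sum_(0 <= k <oo)
     ((dl ^+ 2) ^+ k / k`!%:R / gamma_fun (c + k%:R) * powRpos (c + k%:R) r)%:E)%E.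

Lemma ncgamma_kernel_term_ge0 (c dl r : R) (k : nat) : 0 < c ->
  0 <= (dl ^+ 2) ^+ k / k`!%:R / gamma_fun (c + k%:R) * powRpos (c + k%:R) r.
Proof.
move=> c0; have ck : 0 < c + k%:R by rewrite ltr_wpDr.
have e0 : 0 <= (dl ^+ 2) ^+ k by apply: exprn_ge0; exact: sqr_ge0.
by rewrite mulr_ge0 ?powRpos_ge0// !divr_ge0 ?ler0n// ltW// gamma_fun_gt0.
Qed.

Lemma ncgamma_kernel_ge0 c dl r : 0 < c -> (0 <= ncgamma_kernel c dl r)%E.
Proof.
by move=> c0; apply: nneseries_ge0 => k _ _; rewrite lee_fin ncgamma_kernel_term_ge0.
Qed.

Lemma ncgamma_kernel_eq0 c dl r : r <= 0 -> ncgamma_kernel c dl r = 0%E.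
Proof.
move=> r0; rewrite /ncgamma_kernel; apply: eseries0 => k _ _.
by rewrite /powRpos ltNge r0/= mulr0.
Qed.

Lemma measurable_ncgamma_kernel d (X : measurableType d) c (dl r : X -> R) : 0 < c ->
  measurable_fun [set: X] dl -> measurable_fun [set: X] r ->
  measurable_fun [set: X] (fun w => ncgamma_kernel c (dl w) (r w)).
Proof.
move=> c0 mdl mr; apply: ge0_emeasurable_sum.
  by move=> k w _ _; rewrite lee_fin ncgamma_kernel_term_ge0.
move=> k _; apply/measurable_EFinP; measR.
exact: measurable_powRpos.
Qed.

(** The [k]-th term has transform [s^-c * (dl^2 / s)^k / k!], so the series is
    that of an exponential. *)
Lemma integral_ncgamma_kernel (c dl s : R) : 0 < c -> 0 < s ->
  (\int[leb]_r (ncgamma_kernel c dl r * (expR (- s * r))%:E) =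
   (s `^ (- c) * expR (dl ^+ 2 / s))%:E)%E.
Proof.
move=> c0 s0.
have ck k : 0 < c + k%:R by rewrite ltr_wpDr.
pose a k := (dl ^+ 2) ^+ k / k`!%:R / gamma_fun (c + k%:R).
have a0 k : 0 <= a k.
  have e0 : 0 <= (dl ^+ 2) ^+ k by apply: exprn_ge0; exact: sqr_ge0.
  by rewrite !divr_ge0 ?ler0n// ltW// gamma_fun_gt0.
transitivity (\int[leb]_r \sum_(0 <= k <oo)
   ((a k)%:E * (powRpos (c + k%:R) r * expR (- s * r))%:E))%E.
  apply: eq_integral => r _; rewrite muleC /ncgamma_kernel -nneseriesZl; last first.
    by move=> k _; rewrite lee_fin ncgamma_kernel_term_ge0.
  by apply: eq_eseriesr => k _; rewrite -!EFinM -/(a k) mulrCA [expR _ * _]mulrC.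
rewrite integral_nneseries//; last 2 first.
- move=> k; apply: measurable_funeM; exact: measurable_gamma_integrand.
- by move=> k x _; rewrite mule_ge0// lee_fin ?a0 ?gamma_integrand_ge0.
transitivity (\sum_(0 <= k <oo)
  ((s `^ (- c))%:E * ((dl ^+ 2 / s) ^+ k / k`!%:R)%:E))%E.
  apply: eq_eseriesr => k _; rewrite ge0_integralZl//; last 3 first.
  - exact: measurable_gamma_integrand.
  - by move=> x _; rewrite lee_fin gamma_integrand_ge0.
  - by rewrite lee_fin a0.
  rewrite integral_gamma// -!EFinM /a; congr EFin.
  rewrite opprD powRD ?(gt_eqF s0) ?implybT// powR_invn ?ltW// expr_div_n.
  have := gamma_fun_gt0 (ck k) => /gt_eqF G0.
  by field; rewrite G0 !gt_eqF ?exprn_gt0// ltr0n fact_gt0.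
rewrite nneseriesZl; last first.
  by move=> k _; rewrite lee_fin divr_ge0 ?ler0n// exprn_ge0// divr_ge0 ?sqr_ge0// ltW.
by rewrite nneseries_expR ?divr_ge0 ?sqr_ge0 ?ltW// EFinM.
Qed.

End GammaKernel.

Section SqrtKernel.
Context {R : realType}.
Notation mT := (measurableTypeR R).
Notation leb := (@lebesgue_measure R).

(** An integrand with a singularity at [0] is reached in this way from closed
    half-lines on which it is continuous, as integration by substitution
    requires. *)
Lemma cvg_integral_oy (f : mT -> \bar R) (u : nat -> R) :
  measurable_fun setT f -> (forall x, 0 <= f x)%E ->
  (forall n, 0 < u n) -> {homo u : m n / (m <= n)%N >-> n <= m} ->
  (forall x, 0 < x -> exists n, u n <= x) ->
  (\int[leb]_(x in `[u n, +oo[) f x @[n --> \oo] -->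
   \int[leb]_(x in `]0%R, +oo[) f x)%E.
Proof.
move=> mf f0 u0 ndu ux.
pose U n : set mT := [set` `[u n, +oo[].
have -> : [set` `]0%R, +oo[] = \bigcup_n U n.
  apply/seteqP; split => [x/=|x [n _]]/=; rewrite /U/= !in_itv/= ?andbT.
    by move=> /ux[n unx]; exists n => //; rewrite /U/= in_itv/= andbT.
  exact: lt_le_trans.
apply: (ge0_nondecreasing_set_cvg_integral (mu := leb)).
- move=> m n mn; apply/subsetPset => x; rewrite /U/= !in_itv/= !andbT.
  by apply: le_trans; exact: ndu.
- by move=> n; exact: measurable_itv.
- by move=> n; exact: measurable_funTS.
- by move=> n x _; exact: f0.
Qed.

Let G (s g l : R) := expR (- s * l ^+ 2 + 2 * g * l).

Let mG s g : measurable_fun [set: mT] (fun l => (G s g l)%:E).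
Proof. by apply/measurable_EFinP; rewrite /G; measR. Qed.

Let cG s g : continuous (G s g).
Proof.
move=> l; apply: continuous_comp; last exact: continuous_expR.
apply: (@continuousD _ _ _ (fun l : R => - s * l ^+ 2) (fun l : R => 2 * g * l)).
  apply: (@continuousM _ _ (cst (- s)) (fun l : R => l ^+ 2)).
    exact: cst_continuous.
  exact: exprn_continuous.
apply: (@continuousM _ _ (cst (2 * g)) (fun l : R => l)).
  exact: cst_continuous.
exact: cvg_id.
Qed.

Let sub_sqrt s g (a : R) : 0 < a ->
  (\int[leb]_(l in `[a, +oo[) (G s g l)%:E =
   \int[leb]_(w in `[(a ^+ 2)%R, +oo[) (G s g (Num.sqrt w) / (2 * Num.sqrt w))%:E)%E.
Proof.
move=> a0; have a20 : 0 < a ^+ 2 by rewrite exprn_gt0.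
have Fa : Num.sqrt (a ^+ 2) = a by rewrite sqrtr_sqr ger0_norm// ltW.
have dS (w : R) : 0 < w -> derive1 (@Num.sqrt R) w = (2 * Num.sqrt w)^-1.
  by move=> w0; rewrite derive1E; have [_ ->] := is_derive1_sqrt w0.
have cV (w : R) : 0 < w -> {for w, continuous (fun w : R => (2 * Num.sqrt w)^-1)}.
  move=> w0; apply: (@continuousV _ _ (fun w : R => 2 * Num.sqrt w)).
    by rewrite mulf_neq0// gt_eqF// sqrtr_gt0.
  apply: (@continuousM _ _ (cst 2) (fun w : R => Num.sqrt w)).
    exact: cst_continuous.
  exact: sqrt_continuous.
have near_dS (w : R) : 0 < w ->
    {near w, (fun w : R => (2 * Num.sqrt w)^-1) =1 derive1 (@Num.sqrt R)}.
  move=> w0; near=> y; rewrite dS//.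
  by near: y; exact: lt_nbhsr.
rewrite -[in LHS]Fa (@increasing_ge0_integration_by_substitutiony _ (@Num.sqrt R)).
- apply: eq_integral => w; rewrite inE/= in_itv/= andbT => aw.
  by rewrite fctE/= dS// (lt_le_trans a20).
- move=> x y; rewrite !in_itv/= !andbT => ax ay xy.
  by rewrite ltr_sqrt// (lt_le_trans a20).
- move=> x; rewrite in_itv/= andbT => ax.
  have x0 := lt_trans a20 ax.
  rewrite /prop_for /continuous_at dS//.
  apply: cvg_trans (cV x x0); apply: near_eq_cvg; exact: near_dS.
- apply/cvg_ex; exists (2 * Num.sqrt (a ^+ 2))^-1.
  apply: cvg_at_right_filter.
  apply: cvg_trans (cV _ a20); apply: near_eq_cvg; exact: near_dS.
- apply/cvg_ex; exists 0.
  apply: (@cvg_trans _ ((fun w : R => (2 * Num.sqrt w)^-1) @ +oo)).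
    apply: near_eq_cvg; near=> w; rewrite dS//.
  apply/(@gtr0_cvgV0 _ _ _ _ (fun w : R => 2 * Num.sqrt w)).
    near=> w; rewrite mulr_gt0// sqrtr_gt0.
    by near: w; exact: nbhs_pinfty_gt.
  apply/cvgryPge => A; near=> w.
  have A0 : 0 <= Num.max A 0 by rewrite le_max lexx orbT.
  apply: (@le_trans _ _ (2 * Num.max A 0)).
    by rewrite (@le_trans _ _ (Num.max A 0))// ?le_max ?lexx// ler_peMl// ler1n.
  rewrite ler_pM2l// -(ger0_norm A0) -sqrtr_sqr ler_wsqrtr//.
- split.
  + move=> x; rewrite in_itv/= andbT => ax.
    by have [] := is_derive1_sqrt (lt_trans a20 ax).
  + exact/cvg_at_right_filter/sqrt_continuous.
- apply/cvgryPge => A; near=> w.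
  rewrite (le_trans (ler_norm A))// -sqrtr_sqr ler_wsqrtr//.
- exact/continuous_subspaceT/cG.
- by move=> l _; rewrite expR_ge0.
Unshelve. all: end_near. Qed.

Let integral_half s g :
  (\int[leb]_w (powRpos 2^-1 w * expR (- s * w + 2 * g * Num.sqrt w))%:E =
   2%:E * \int[leb]_(l in `]0%R, +oo[) (G s g l)%:E)%E.
Proof.
pose F (w : R) := powRpos 2^-1 w * expR (- s * w + 2 * g * Num.sqrt w).
have F0 w : (0 <= (F w)%:E)%E by rewrite lee_fin mulr_ge0 ?powRpos_ge0 ?expR_ge0.
have mF : measurable_fun [set: mT] (fun w => (F w)%:E).
  by apply/measurable_EFinP; rewrite /F; measR; exact: measurable_powRpos.
have -> : (\int[leb]_w (F w)%:E = \int[leb]_(w in `]0%R, +oo[) (F w)%:E)%E.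
  rewrite [RHS]integral_mkcond; apply: eq_integral => w _.
  rewrite patchE mem_setE in_itv/= andbT; case: ifPn => // /negbTE w0.
  by rewrite /F /powRpos w0 mul0r.
(* The substitution [w = l^2] on the half-line from [u n] on, as [u n] tends
   to [0]. *)
pose u n : R := n.+1%:R^-1.
have u0 n : 0 < u n by rewrite invr_gt0.
have ndu : {homo u : m n / (m <= n)%N >-> n <= m}.
  by move=> m n mn; rewrite lef_pV2 ?posrE// ler_nat ltnS.
have ux (x : R) : 0 < x -> exists n, u n <= x.
  move=> x0; exists (Num.bound x^-1); rewrite /u invf_ple ?posrE//.
  have x10 : 0 <= x^-1 by rewrite invr_ge0 ltW.
  by rewrite (le_trans (ltW (archi_boundP x10)))// ler_nat.
have u20 n : 0 < u n ^+ 2 by rewrite exprn_gt0.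
have ndu2 : {homo (fun n => u n ^+ 2) : m n / (m <= n)%N >-> n <= m}.
  by move=> m n mn; apply: lerXn2r; rewrite ?nnegrE ?(ltW (u0 _))// ndu.
have u2x (x : R) : 0 < x -> exists n, u n ^+ 2 <= x.
  move=> /ux[n unx]; exists n; rewrite (le_trans _ unx)// expr2 ler_piMl ?(ltW (u0 _))//.
  by rewrite /u invf_le1// ler1n.
have cF := cvg_integral_oy mF F0 u20 ndu2 u2x.
have G0 l : (0 <= (G s g l)%:E)%E by rewrite lee_fin expR_ge0.
have cG' := cvg_integral_oy (mG s g) G0 u0 ndu ux.
rewrite -(cvg_lim _ cF)// -(cvg_lim _ (cvgeZl _ cG'))//.
congr (limn _); apply/funext => n; rewrite sub_sqrt//.
rewrite -ge0_integralZl//; last 2 first.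
- apply/measurable_EFinP/measurable_funTS; rewrite /G; measR.
- move=> x; rewrite /= in_itv/= andbT => ax.
  by rewrite lee_fin divr_ge0 ?expR_ge0// mulr_ge0// sqrtr_ge0.
apply: eq_integral => w; rewrite inE/= in_itv/= andbT => aw.
have w0 : 0 < w by exact: lt_le_trans aw.
rewrite -EFinM /F /powRpos w0 (_ : 2^-1 - 1 = - 2^-1); last by field.
rewrite powRN powR12_sqrt ?ltW// /G sqr_sqrtr ?ltW//; congr EFin.
by field; rewrite gt_eqF// sqrtr_gt0.
Qed.

Let integral_reflect s g :
  (\int[leb]_(l in `]0%R, +oo[) (G s g l)%:E +
   \int[leb]_(l in `]0%R, +oo[) (G s (- g) l)%:E =
   \int[leb]_l (G s g l)%:E)%E.
Proof.
have G0 g' l : (0 <= (G s g' l)%:E)%E by rewrite lee_fin expR_ge0.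
have -> : (\int[leb]_(l in `]0%R, +oo[) (G s (- g) l)%:E =
    \int[leb]_(l in `]-oo, 0%R]) (G s g l)%:E)%E.
  rewrite integral_itv_obnd_cbnd; last exact: (measurable_funTS (mG s (- g))).
  rewrite (@ge0_integration_by_substitution0 R (fun l => (G s (- g) l)%:E))//; last exact: (mG s (- g)).
  apply: eq_integral => l _; rewrite /G sqrrN; congr (expR (_ + _))%:E; ring.
rewrite addeC -ge0_integral_setU//=.
- congr (integral _ _ _); apply/seteqP; split => // x _ /=.
  by rewrite !in_itv/= andbT; case: (leP x 0) => ?; [left|right].
- apply: measurable_funTS; exact: (mG s).
- apply/disj_setPS => x [] /=; rewrite !in_itv/= andbT => x0.
  by rewrite ltNge x0.
Qed.

(** The law of the square [w] of a real Gaussian variable [l]: under [w = l^2]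
    the two exponentials become the two halves [l > 0] and [l < 0] of a Gaussian
    integral. *)
Lemma integral_sqrt_exp (s g : R) : 0 < s ->
  (\int[leb]_w (powRpos 2^-1 w * expR (- s * w) *
     (expR (2 * g * Num.sqrt w) + expR (- 2 * g * Num.sqrt w)))%:E =
   (2 * (Num.sqrt pi / Num.sqrt s * expR (g ^+ 2 / s)))%:E)%E.
Proof.
move=> s0.
transitivity (\int[leb]_w (
    (powRpos 2^-1 w * expR (- s * w + 2 * g * Num.sqrt w))%:E +
    (powRpos 2^-1 w * expR (- s * w + 2 * (- g) * Num.sqrt w))%:E))%E.
  apply: eq_integral => w _; rewrite -EFinD -mulrDr !expRD -mulrDr mulrA.
  by rewrite !mulrN mulNr.
rewrite ge0_integralD//; last 4 first.
- by move=> w _; rewrite lee_fin mulr_ge0 ?powRpos_ge0 ?expR_ge0.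
- by apply/measurable_EFinP; measR; exact: measurable_powRpos.
- by move=> w _; rewrite lee_fin mulr_ge0 ?powRpos_ge0 ?expR_ge0.
- by apply/measurable_EFinP; measR; exact: measurable_powRpos.
rewrite !integral_half -ge0_muleDr ?integral_ge0//; last 2 first.
- by move=> x _; rewrite lee_fin expR_ge0.
- by move=> x _; rewrite lee_fin expR_ge0.
by rewrite integral_reflect integral_gauss_linear// -EFinM.
Qed.

End SqrtKernel.

(** * Noncentral multivariate gamma densities *)

Section Densities.
Context {R : realType}.
Notation mT := (measurableTypeR R).
Notation leb := (@lebesgue_measure R).
Notation tup n := (n.-tuple mT).

(** Entrywise, so that no sigma-algebra on matrices has to be chosen. *)
Definition measurable_mx d (X : measurableType d) n q (M : X -> 'M[R]_(n, q)) :=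
  forall i j, measurable_fun [set: X] (fun w => M w i j).

Section MeasurableMx.
Context d (X : measurableType d).

Lemma measurable_mx_cst n q (A : 'M[R]_(n, q)) : measurable_mx (fun _ : X => A).
Proof. by move=> i j; exact: measurable_cst. Qed.

Lemma measurable_mxD n q (A B : X -> 'M[R]_(n, q)) : measurable_mx A -> measurable_mx B ->
  measurable_mx (fun w => A w + B w).
Proof.
move=> mA mB i j; under eq_fun do rewrite mxE.
exact: measurable_funD.
Qed.

Lemma measurable_mxN n q (A : X -> 'M[R]_(n, q)) : measurable_mx A ->
  measurable_mx (fun w => - A w).
Proof.
move=> mA i j; under eq_fun do rewrite mxE.
exact: measurable_funN.
Qed.

Lemma measurable_mxZ n q (f : X -> R) (A : X -> 'M[R]_(n, q)) :
  measurable_fun [set: X] f -> measurable_mx A -> measurable_mx (fun w => f w *: A w).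
Proof.
move=> mf mA i j; under eq_fun do rewrite mxE.
exact: measurable_funM.
Qed.

Lemma measurable_mxM n q r (A : X -> 'M[R]_(n, q)) (B : X -> 'M[R]_(q, r)) :
  measurable_mx A -> measurable_mx B -> measurable_mx (fun w => A w *m B w).
Proof.
move=> mA mB i j; under eq_fun do rewrite mxE.
by apply: measurable_sum => k; exact: measurable_funM.
Qed.

Lemma measurable_trmx n q (A : X -> 'M[R]_(n, q)) : measurable_mx A ->
  measurable_mx (fun w => (A w)^T).
Proof. by move=> mA i j; under eq_fun do rewrite mxE; exact: mA. Qed.

Lemma measurable_row_mx n q r (A : X -> 'M[R]_(n, q)) (B : X -> 'M[R]_(n, r)) :
  measurable_mx A -> measurable_mx B -> measurable_mx (fun w => row_mx (A w) (B w)).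
Proof.
move=> mA mB i j; under eq_fun do rewrite mxE.
by case: (fintype.split j) => k; [exact: mA|exact: mB].
Qed.

Lemma measurable_col_mx n q r (A : X -> 'M[R]_(n, q)) (B : X -> 'M[R]_(r, q)) :
  measurable_mx A -> measurable_mx B -> measurable_mx (fun w => col_mx (A w) (B w)).
Proof.
move=> mA mB i j; under eq_fun do rewrite mxE.
by case: (fintype.split i) => k; [exact: mA|exact: mB].
Qed.

Lemma measurable_usubmx n q r (A : X -> 'M[R]_(n + r, q)) : measurable_mx A ->
  measurable_mx (fun w => usubmx (A w)).
Proof. by move=> mA i j; under eq_fun do rewrite mxE; exact: mA. Qed.

Lemma measurable_dsubmx n q r (A : X -> 'M[R]_(n + r, q)) : measurable_mx A ->
  measurable_mx (fun w => dsubmx (A w)).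
Proof. by move=> mA i j; under eq_fun do rewrite mxE; exact: mA. Qed.

Lemma measurable_lsubmx n q r (A : X -> 'M[R]_(n, q + r)) : measurable_mx A ->
  measurable_mx (fun w => lsubmx (A w)).
Proof. by move=> mA i j; under eq_fun do rewrite mxE; exact: mA. Qed.

Lemma measurable_rsubmx n q r (A : X -> 'M[R]_(n, q + r)) : measurable_mx A ->
  measurable_mx (fun w => rsubmx (A w)).
Proof. by move=> mA i j; under eq_fun do rewrite mxE; exact: mA. Qed.

Lemma measurable_mx_comp d' (Y : measurableType d') n q (A : Y -> 'M[R]_(n, q))
    (f : X -> Y) :
  measurable_fun [set: X] f -> measurable_mx A -> measurable_mx (fun w => A (f w)).
Proof. by move=> mf mA i j; exact: (measurableT_comp (mA i j) mf). Qed.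

End MeasurableMx.

Definition tdot n (t : 'rV[R]_n) (x : tup n) : R :=
  \sum_j t ord0 j * tnth x j.

Lemma measurable_tdot d (X : measurableType d) n (t : 'rV[R]_n) (x : X -> tup n) :
  measurable_fun [set: X] x -> measurable_fun [set: X] (fun w => tdot t (x w)).
Proof.
move=> mx; apply: measurable_sum => j; apply: measurable_funM => //.
exact: (measurableT_comp (measurable_tnth _) mx).
Qed.

Lemma measurable_exp_tdot d (X : measurableType d) n (t : 'rV[R]_n)
    (x : X -> tup n) : measurable_fun [set: X] x ->
  measurable_fun [set: X] (fun w => (expR (- tdot t (x w)))%:E).
Proof.
move=> mx; apply/measurable_EFinP/measurable_fun_expR/measurable_funN.
exact: measurable_tdot.
Qed.

(** For [Z = Om + T] and up to a constant, the Laplace transform at [T] of the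
    squared lengths of the rows of an [n] x [2 a] Gaussian matrix with independent
    columns.  Each column has precision matrix [2 Om], and [M] is [Om] times the
    matrix of means, expressed in [q] orthonormal directions. *)
Definition ncgamma_laplace n q (a : R) (Z : 'M[R]_n) (M : 'M[R]_(n, q)) : R :=
  (\det Z) `^ (- a) * expR (trace_form Z M M).

Lemma ncgamma_laplace_ge0 n q a Z M : 0 <= @ncgamma_laplace n q a Z M.
Proof. by rewrite mulr_ge0 ?powR_ge0 ?expR_ge0. Qed.

(** [ncg_meas] expresses joint measurability in [M] and [x] through arbitrary
    measurable families, so that parameters can be integrated out; [ncg_supp]
    allows integrating over the whole space. *)
Record is_ncgamma n q (a : R) (Om : 'M[R]_n)
    (G : 'M[R]_(n, q) -> tup n -> \bar R) : Prop := IsNcgamma {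
  ncg_ge0 : forall M x, (0 <= G M x)%E;
  ncg_supp : forall M x, ~ orthant x -> G M x = 0%E;
  ncg_meas : forall d (X : measurableType d) (M : X -> 'M[R]_(n, q))
      (x : X -> tup n), measurable_mx M -> measurable_fun [set: X] x ->
    measurable_fun [set: X] (fun w => G (M w) (x w));
  ncg_lt : forall M (t : 'rV[R]_n), (forall j, 0 <= t ord0 j) ->
    (\int[lebesgue_tuple n]_x ((expR (- tdot t x))%:E * G M x) =
      (ncgamma_laplace a (Om + diag_mx t) M)%:E)%E }.

Definition has_ncgamma n q (a : R) := forall Om : 'M[R]_n, is_posdefmx Om ->
  exists G : 'M[R]_(n, q) -> tup n -> \bar R, is_ncgamma a Om G.

Lemma has_ncgamma0 q a : has_ncgamma 0 q a.
Proof.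
move=> Om Omp; exists (fun _ _ => 1%E); split => //.
  by move=> M x []; case.
move=> M t _; rewrite integral_tuple0; last first.
  by under eq_fun do rewrite mule1; exact: measurable_exp_tdot.
rewrite /tdot big_ord0 oppr0 expR0 mul1e /ncgamma_laplace det_mx00 powR1.
by rewrite [M]flatmx0 /trace_form mulmx0 mxtrace0 expR0 mulr1.
Qed.

Lemma tdot_tuple_sub n (t : 'rV[R]_n) (x y : tup n) :
  tdot t x = tdot t (tuple_sub x y) + tdot t y.
Proof.
rewrite /tdot -big_split/=; apply: eq_bigr => j _.
by rewrite tnth_mktuple -mulrDr subrK.
Qed.

(** A convolution multiplies the Laplace transforms: the powers of the
    determinant and, since the columns of [M] are shared out between the two
    factors, the traces in the exponent add up.  In terms of Gaussian vectors,
    their components in two orthogonal subspaces are independent. *)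
Lemma has_ncgamma_conv n q1 q2 a1 a2 :
  has_ncgamma n q1 a1 -> has_ncgamma n q2 a2 ->
  has_ncgamma n (q1 + q2) (a1 + a2).
Proof.
move=> h1 h2 Om Omp; have [G1 g1] := h1 Om Omp; have [G2 g2] := h2 Om Omp.
pose F (M : 'M[R]_(n, q1 + q2)) x y :=
  (G1 (lsubmx M) y * G2 (rsubmx M) (tuple_sub x y))%E.
have F0 M x y : (0 <= F M x y)%E.
  by apply: mule_ge0; [exact: ncg_ge0 g1 _ _|exact: ncg_ge0 g2 _ _].
have mF d (X : measurableType d) M (x y : X -> tup n) :
    measurable_mx M -> measurable_fun [set: X] x -> measurable_fun [set: X] y ->
    measurable_fun [set: X] (fun w => F (M w) (x w) (y w)).
  move=> mM mx my; apply: emeasurable_funM.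
    by apply: (ncg_meas g1) => //; exact: measurable_lsubmx.
  apply: (ncg_meas g2); first exact: measurable_rsubmx.
  exact: measurable_tuple_sub.
exists (fun M x => \int[lebesgue_tuple n]_y F M x y)%E; split.
- by move=> M x; apply: integral_ge0 => y _.
- move=> M x xn; apply: integral0_eq => y _.
  have [y0|y0] := pselect (orthant y); last by rewrite /F (ncg_supp g1 _ y0) mul0e.
  have [z0|z0] := pselect (orthant (tuple_sub x y)); last first.
    by rewrite /F (ncg_supp g2 _ z0) mule0.
  exfalso; apply: xn => j; have := z0 j; rewrite tnth_mktuple subr_gt0.
  exact: lt_trans (y0 j).
- move=> d X M x mM mx.
  apply: (measurable_fun_fubini_tonelli_F
    (fun z : X * tup n => F (M z.1) (x z.1) z.2)) => //.
  apply: mF => //; first exact: measurable_mx_comp.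
  exact: measurableT_comp.
move=> M t t0.
pose e x := expR (- tdot t x).
have me d (X : measurableType d) (x : X -> tup n) : measurable_fun [set: X] x ->
    measurable_fun [set: X] (fun w => (e (x w))%:E).
  exact: measurable_exp_tdot.
have e0 x : (0 <= (e x)%:E)%E by rewrite lee_fin expR_ge0.
transitivity (\int[lebesgue_tuple n]_x \int[lebesgue_tuple n]_y
    ((e x)%:E * F M x y))%E.
  apply: eq_integral => x _; rewrite ge0_integralZl//.
  by apply: mF => //; exact: measurable_mx_cst.
rewrite (fubini_tonelli (fun z : tup n * tup n => (e z.1)%:E * F M z.1 z.2)%E)//;
  last 2 first.
- apply: emeasurable_funM; first exact: me.
  by apply: mF => //; exact: measurable_mx_cst.
- by move=> z; apply: mule_ge0.
set C2 := ncgamma_laplace a2 (Om + diag_mx t) (rsubmx M).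
transitivity (\int[lebesgue_tuple n]_y
    ((e y)%:E * G1 (lsubmx M) y * C2%:E))%E.
  apply: eq_integral => y _.
  rewrite -(ncg_lt g2)// -ge0_integralZl//=; last 3 first.
  - apply: emeasurable_funM; first exact: me.
    by apply: (ncg_meas g2) => //; exact: measurable_mx_cst.
  - by move=> x _; apply: mule_ge0 => //; exact: ncg_ge0 g2 _ _.
  - by apply: mule_ge0 => //; exact: ncg_ge0 g1 _ _.
  rewrite -[RHS](@integral_tuple_sub R n y (fun x => (e y)%:E * G1 (lsubmx M) y *
    ((e x)%:E * G2 (rsubmx M) x))%E); last 2 first.
  - apply: measurable_funeM; apply: emeasurable_funM; first exact: me.
    by apply: (ncg_meas g2) => //; exact: measurable_mx_cst.
  - move=> x; do 2?[apply: mule_ge0 => //];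
    [exact: ncg_ge0 g1 _ _|exact: ncg_ge0 g2 _ _].
  apply: eq_integral => x _; rewrite /F /e (tdot_tuple_sub t x y) opprD expRD EFinM.
  rewrite [X in (X * _ = _)%E]muleC; exact: muleACA.
rewrite ge0_integralZr//; last 3 first.
- apply: emeasurable_funM; first exact: me.
  by apply: (ncg_meas g1) => //; exact: measurable_mx_cst.
- by move=> x _; apply: mule_ge0 => //; exact: ncg_ge0 g1 _ _.
- by rewrite lee_fin ncgamma_laplace_ge0.
rewrite (ncg_lt g1)// -EFinM /C2 /ncgamma_laplace; congr EFin.
rewrite mulrACA -expRD -trace_form_row_mx hsubmxK -powRD -?opprD//.
have := posdef_det (posdef_add_diag Omp t0) => /gt_eqF ->.
exact: implybT.
Qed.

End Densities.

(** * One degree of freedom *)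

Section Recursion.
Context {R : realType}.
Notation mT := (measurableTypeR R).
Notation leb := (@lebesgue_measure R).
Notation tup n := (n.-tuple mT).

Section blocks.
Variables (n : nat) (Om : 'M[R]_(1 + n)) (t : 'rV[R]_(1 + n)).

Lemma drsubmx_add_diag :
  drsubmx (Om + diag_mx t) = drsubmx Om + diag_mx (rsubmx t).
Proof. by apply/matrixP => i j; rewrite !mxE eq_rshift. Qed.

Lemma dlsubmx_add_diag : dlsubmx (Om + diag_mx t) = dlsubmx Om.
Proof. by apply/matrixP => i j; rewrite !mxE eq_rlshift mulr0n addr0. Qed.

Lemma add_diag00 :
  (Om + diag_mx t) ord0 ord0 = Om ord0 ord0 + t ord0 ord0.
Proof. by rewrite !mxE eqxx mulr1n. Qed.

Lemma tdot_cons w (x : tup n) :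
  tdot t [tuple of w :: x] = t ord0 ord0 * w + tdot (rsubmx t) x.
Proof.
rewrite /tdot big_ord_recl tnth_cons0; congr (_ + _); apply: eq_bigr => j _.
by rewrite tnth_consS mxE; congr (t _ _ * _); exact/val_inj.
Qed.

End blocks.

Lemma orthant_consP n (x : tup n.+1) :
  0 < thead x -> orthant [tuple of behead x] -> orthant x.
Proof.
move=> x0 xb j; have [->//|] := eqVneq j ord0.
rewrite eq_sym => /unlift_some[k -> _].
by have := xb k; rewrite [in X in _ -> X](tuple_eta x) tnthS.
Qed.

Lemma measurable_thead d (X : measurableType d) n (x : X -> tup n.+1) :
  measurable_fun [set: X] x -> measurable_fun [set: X] (fun w => thead (x w)).
Proof. exact: (measurableT_comp (measurable_tnth _)). Qed.

Lemma measurable_tbehead d (X : measurableType d) n (x : X -> tup n.+1) :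
  measurable_fun [set: X] x ->
  measurable_fun [set: X] (fun w => [tuple of behead (x w)] : tup n).
Proof.
move=> mx; have mb : measurable_fun [set: tup n.+1] (fun x : tup n.+1 => [tuple of behead x] : tup n).
  exact: measurable_behead.
exact: (measurableT_comp mb mx).
Qed.

Lemma behead_cons n (w : mT) (x : tup n) :
  [tuple of behead [tuple of w :: x]] = x :> tup n.
Proof. exact: val_inj. Qed.

Lemma integral_slice n (t : 'rV[R]_(1 + n)) (G : tup n.+1 -> \bar R) :
  measurable_fun [set: tup n.+1] G -> (forall x, 0 <= G x)%E ->
  (\int[lebesgue_tuple n.+1]_x ((expR (- tdot t x))%:E * G x) =
   \int[leb]_w \int[lebesgue_tuple n]_x
     ((expR (- (t ord0 ord0 * w)))%:E * (expR (- tdot (rsubmx t) x))%:E *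
       G [tuple of w :: x]))%E.
Proof.
move=> mG G0; rewrite integral_tupleS; last 2 first.
- apply: emeasurable_funM => //; exact: measurable_exp_tdot.
- by move=> x; rewrite mule_ge0// lee_fin expR_ge0.
apply: eq_integral => w _; apply: eq_integral => x _.
by rewrite tdot_cons opprD expRD EFinM.
Qed.

Lemma ncgamma_laplace_schur n q a (Z : 'M[R]_(1 + n)) (M : 'M[R]_(1 + n, q)) :
  is_posdefmx Z ->
  ncgamma_laplace a Z M =
  ncgamma_laplace a (drsubmx Z) (dsubmx M) * ((schur_compl Z) `^ (- a) *
    expR ((\sum_j (usubmx M - (dlsubmx Z)^T *m invmx (drsubmx Z) *m dsubmx M)
      ord0 j ^+ 2) / schur_compl Z)).
Proof.
move=> Zp; rewrite /ncgamma_laplace det_schur// trace_form_schur// powRM; last 2 first.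
- exact/ltW/schur_compl_gt0.
- exact/ltW/posdef_det/posdef_drsubmx.
by rewrite expRD [(schur_compl Z)^-1 * _]mulrC; ring.
Qed.

(** The law of the squares of [n] correlated real Gaussian variables.  The first
    one is [sg * sqrt w] for a sign [sg]; given its value, the others are again
    Gaussian with [M] shifted by [- sg * sqrt w * b].  The sum over both signs is
    the integrand of [integral_sqrt_exp]. *)
Lemma has_ncgamma_half n : has_ncgamma n 1 (2^-1 : R).
Proof.
elim: n => [|n IHn]; first exact: has_ncgamma0.
move=> Om Omp.
have [G' g'] := IHn (drsubmx (Om : 'M[R]_(1 + n))) (posdef_drsubmx Omp).
pose b : 'cV[R]_n := dlsubmx (Om : 'M[R]_(1 + n)).
pose Gs (sg : R) (u : 'M[R]_(1 + n, 1)) (w : R) (x : tup n) :=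
  ((expR (2 * (sg * u ord0 ord0) * Num.sqrt w))%:E *
   G' (dsubmx u - (sg * Num.sqrt w) *: b)%R x)%E.
have Gs0 sg u w x : (0 <= Gs sg u w x)%E.
  by rewrite mule_ge0 ?lee_fin ?expR_ge0//; exact: ncg_ge0 g' _ _.
have mGs sg d (X : measurableType d) u (w : X -> R) x :
    measurable_mx u -> measurable_fun [set: X] w -> measurable_fun [set: X] x ->
    measurable_fun [set: X] (fun z => Gs sg (u z) (w z) (x z)).
  move=> mu mw mx; apply: emeasurable_funM.
    apply/measurable_EFinP; measR; exact: mu.
  apply: (ncg_meas g') => //; apply: measurable_mxD; first exact: measurable_dsubmx.
  apply: measurable_mxN; apply: measurable_mxZ; last exact: measurable_mx_cst.
  by measR.
pose k (w : R) := powRpos 2^-1 w * expR (- Om ord0 ord0 * w) / (2 * Num.sqrt pi).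
have k0 w : 0 <= k w.
  by rewrite divr_ge0 ?mulr_ge0 ?powRpos_ge0 ?expR_ge0 ?sqrtr_ge0.
have mk d (X : measurableType d) (w : X -> R) : measurable_fun [set: X] w ->
    measurable_fun [set: X] (fun z => (k (w z))%:E).
  by move=> mw; apply/measurable_EFinP; rewrite /k; measR; exact: measurable_powRpos.
pose H u w x := ((k w)%:E * (Gs 1%R u w x + Gs (- 1)%R u w x))%E.
have mH d (X : measurableType d) u (w : X -> R) x :
    measurable_mx u -> measurable_fun [set: X] w -> measurable_fun [set: X] x ->
    measurable_fun [set: X] (fun z => H (u z) (w z) (x z)).
  move=> mu mw mx; apply: emeasurable_funM; first exact: mk.
  by apply: emeasurable_funD; exact: mGs.
exists (fun u x => H u (thead x) [tuple of behead x]); split.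
- by move=> u x; rewrite mule_ge0 ?lee_fin ?k0// adde_ge0.
- move=> u x nx; have [x0|x0] := ltP 0 (thead x); last first.
    by rewrite /H /k /powRpos ltNge x0/= !mul0r mul0e.
  rewrite /H /Gs !(ncg_supp g') ?mule0 ?adde0 ?mule0// => xb;
  exact/nx/orthant_consP.
- move=> d X u x mu mx; apply: mH => //; first exact: measurable_thead.
  exact: measurable_tbehead.
move=> u t t0.
pose t' : 'rV[R]_n := rsubmx (t : 'rV[R]_(1 + n)).
rewrite integral_slice; last 2 first.
- apply: mH; [exact: measurable_mx_cst|exact: measurable_thead|exact: measurable_tbehead].
- by move=> x; rewrite mule_ge0 ?lee_fin ?k0// adde_ge0.
have Zp := posdef_add_diag Omp t0.
set Z : 'M[R]_(1 + n) := _ + _ in Zp *.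
have Z'p := posdef_drsubmx Zp.
have Z'E : drsubmx Z = drsubmx (Om : 'M[R]_(1 + n)) + diag_mx t'.
  exact: drsubmx_add_diag.
have bE : dlsubmx Z = b by exact: dlsubmx_add_diag.
have t'0 j : 0 <= t' ord0 j by rewrite mxE t0.
set Z' := drsubmx Z in Z'p Z'E.
pose u' : 'cV[R]_n := dsubmx (u : 'M[R]_(1 + n, 1)).
pose beta := trace_form Z' b b; pose g := u ord0 ord0 - trace_form Z' b u'.
pose C := ncgamma_laplace 2^-1 Z' u'.
have sE : schur_compl Z = Z ord0 ord0 - beta by rewrite /schur_compl bE.
have s0 : 0 < schur_compl Z by exact: schur_compl_gt0.
have ltE sg (w : R) : sg ^+ 2 = 1 -> 0 < w ->
    ncgamma_laplace 2^-1 Z' (u' - (sg * Num.sqrt w) *: b) =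
    C * expR (beta * w - 2 * sg * trace_form Z' b u' * Num.sqrt w).
  move=> sg2 w0; rewrite /C /ncgamma_laplace -mulrA -expRD; congr (_ * expR _).
  rewrite -scaleNr trace_formDl !trace_formDr !trace_formZl !trace_formZr.
  rewrite (trace_formC u' b) ?(posdef_sym Z'p)// -/beta.
  have -> : beta * w = beta * (sg ^+ 2 * Num.sqrt w ^+ 2).
    by rewrite sg2 mul1r sqr_sqrtr// ltW.
  by ring.
have slice sg w : sg ^+ 2 = 1 -> 0 < w ->
    (\int[lebesgue_tuple n]_x ((expR (- tdot t' x))%:E *
       Gs sg u w x) =
     (C * expR (beta * w + 2 * sg * g * Num.sqrt w))%:E)%E.
  move=> sg2 w0.
  transitivity (\int[lebesgue_tuple n]_x ((expR (2 * (sg * u ord0 ord0) * Num.sqrt w))%:E *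
     ((expR (- tdot t' x))%:E *
       G' (u' - (sg * Num.sqrt w) *: b)%R x)))%E.
    by apply: eq_integral => x _; rewrite /Gs muleCA.
  rewrite ge0_integralZl//; last 2 first.
  - apply: emeasurable_funM; first exact: measurable_exp_tdot.
    by apply: (ncg_meas g') => //; exact: measurable_mx_cst.
  - by move=> x _; rewrite mule_ge0 ?lee_fin ?expR_ge0//; exact: ncg_ge0 g' _ _.
  rewrite (ncg_lt g')// -Z'E ltE// -EFinM mulrCA -expRD; congr (_ * expR _)%:E.
  by rewrite /g; ring.
transitivity (\int[leb]_w ((C / (2 * Num.sqrt pi))%:E *
   (powRpos 2^-1 w * expR (- schur_compl Z * w) *
     (expR (2 * g * Num.sqrt w) + expR (- 2 * g * Num.sqrt w)))%:E))%E.
  apply: eq_integral => w _.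
  have [w0|w0] := ltP 0 w; last first.
    rewrite [in RHS]/powRpos ltNge w0/= !mul0r mule0.
    by apply: integral0_eq => x _; rewrite /H /k /powRpos ltNge w0/= !mul0r mul0e mule0.
  transitivity (\int[lebesgue_tuple n]_x (
    (expR (- (t ord0 ord0 * w)) * k w)%:E *
    ((expR (- tdot t' x))%:E * Gs 1%R u w x +
     (expR (- tdot t' x))%:E * Gs (- 1)%R u w x)))%E.
    apply: eq_integral => x _; rewrite -ge0_muleDr// EFinM.
    rewrite /H theadE behead_cons.
    exact: muleACA.
  have msl sg : measurable_fun [set: tup n] (fun x =>
      (expR (- tdot t' x))%:E * Gs sg u w x)%E.
    apply: emeasurable_funM; first exact: measurable_exp_tdot.
    by apply: mGs => //; exact: measurable_mx_cst.
  have sl0 sg x : (0 <= (expR (- tdot t' x))%:E * Gs sg u w x)%E.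
    by rewrite mule_ge0 ?lee_fin ?expR_ge0.
  rewrite ge0_integralZl//; last 3 first.
  - exact: emeasurable_funD.
  - by move=> x _; rewrite adde_ge0.
  - by rewrite lee_fin mulr_ge0 ?expR_ge0.
  rewrite ge0_integralD// !slice ?sqrrN ?expr1n// -EFinD -!EFinM; congr EFin.
  rewrite !expRD -mulrDr /k.
  have -> : - schur_compl Z * w = - (t ord0 ord0 * w) + - Om ord0 ord0 * w + beta * w.
    by rewrite sE add_diag00; ring.
  rewrite !expRD mulr1 mulrN1.
  by field; rewrite gt_eqF// sqrtr_gt0 pi_gt0.
rewrite ge0_integralZl//; last 3 first.
- apply/measurable_EFinP; measR; exact: measurable_powRpos.
- by move=> w _; rewrite lee_fin !mulr_ge0 ?addr_ge0 ?expR_ge0 ?powRpos_ge0.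
- by rewrite lee_fin divr_ge0 ?ncgamma_laplace_ge0// mulr_ge0// sqrtr_ge0.
rewrite integral_sqrt_exp// ncgamma_laplace_schur// -/Z' -/u' -/C -EFinM.
rewrite powRN powR12_sqrt ?ltW// big_ord1 bE.
have -> : (usubmx (u : 'M[R]_(1 + n, 1)) - b^T *m invmx Z' *m u') ord0 ord0 = g.
  rewrite mxE [X in _ + X]mxE mxE /g /trace_form trace_mx11; congr (u _ _ - _).
  exact: val_inj.
by congr EFin; field; rewrite !gt_eqF// sqrtr_gt0 ?pi_gt0.
Qed.

End Recursion.

(** * Splitting off the first vector *)

Section Peel.
Context {R : realType}.
Notation mT := (measurableTypeR R).
Notation leb := (@lebesgue_measure R).
Notation tup n := (n.-tuple mT).

Definition sumsq q (y : tup q) : R := \sum_j tnth y j ^+ 2.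
Definition lincomb q (m : 'I_q -> R) (y : tup q) : R := \sum_j m j * tnth y j.

Lemma sumsq_ge0 q (y : tup q) : 0 <= sumsq y.
Proof. by apply: sumr_ge0 => j _; exact: sqr_ge0. Qed.

Lemma measurable_sumsq d (X : measurableType d) q (y : X -> tup q) :
  measurable_fun [set: X] y -> measurable_fun [set: X] (fun w => sumsq (y w)).
Proof.
move=> my; apply: measurable_sum => j; apply: measurable_funX.
exact: (measurableT_comp (measurable_tnth _) my).
Qed.

Lemma measurable_lincomb d (X : measurableType d) q (m : 'I_q -> X -> R)
    (y : X -> tup q) :
  (forall j, measurable_fun [set: X] (m j)) -> measurable_fun [set: X] y ->
  measurable_fun [set: X] (fun w => lincomb (m^~ w) (y w)).
Proof.
move=> mm my; apply: measurable_sum => j; apply: measurable_funM => //.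
exact: (measurableT_comp (measurable_tnth _) my).
Qed.

Section integral_peel.
Variables (q n : nat) (c dl z beta C : R) (m ka : 'I_q -> R).
Variables (e : tup n -> R) (H : mT -> tup q -> tup n -> \bar R).
Hypotheses (c0 : 0 < c) (bz : beta < z) (C0 : 0 <= C).
Hypotheses (me : measurable_fun [set: tup n] (fun x => (e x)%:E))
  (e0 : forall x, 0 <= e x).
Hypotheses
  (mH : forall d (X : measurableType d) (w : X -> mT) y x,
    measurable_fun [set: X] w -> measurable_fun [set: X] y ->
    measurable_fun [set: X] x ->
    measurable_fun [set: X] (fun p => H (w p) (y p) (x p)))
  (H0 : forall w y x, (0 <= H w y x)%E).
Hypothesis HE : forall w y, sumsq y < w ->
  (\int[lebesgue_tuple n]_x ((e x)%:E * H w y x) =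
   (C * expR (beta * w - 2 * lincomb ka y))%:E)%E.

Let s := z - beta.
Let s0 : 0 < s. Proof. by rewrite subr_gt0. Qed.

Let k w y x : \bar R :=
  (ncgamma_kernel c dl (w - sumsq y)%R * (expR (2 * lincomb m y))%:E * H w y x)%E.

Let mk d (X : measurableType d) (w : X -> mT) y x :
  measurable_fun [set: X] w -> measurable_fun [set: X] y ->
  measurable_fun [set: X] x ->
  measurable_fun [set: X] (fun p => k (w p) (y p) (x p)).
Proof.
move=> mw my mx; apply: emeasurable_funM; last exact: mH.
apply: emeasurable_funM.
  apply: measurable_ncgamma_kernel => //; apply: measurable_funB => //.
  exact: measurable_sumsq.
apply/measurable_EFinP/measurable_fun_expR/measurable_funM => //.
exact: measurable_lincomb.
Qed.

Let k0 w y x : (0 <= k w y x)%E.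
Proof. by rewrite !mule_ge0 ?ncgamma_kernel_ge0 ?lee_fin ?expR_ge0. Qed.

Let L y := lincomb (fun j => m j - ka j) y.

Let LE y : lincomb m y = L y + lincomb ka y.
Proof.
rewrite /L /lincomb -big_split/=; apply: eq_bigr => j _.
by rewrite -mulrDl subrK.
Qed.

Let mL d (X : measurableType d) (y : X -> tup q) :
  measurable_fun [set: X] y -> measurable_fun [set: X] (fun w => L (y w)).
Proof. by move=> my; exact: measurable_lincomb. Qed.

Let peel1 w :
  (\int[lebesgue_tuple n]_x ((expR (- (z * w)))%:E * (e x)%:E *
     \int[lebesgue_tuple q]_y k w y x) =
   \int[lebesgue_tuple q]_y (ncgamma_kernel c dl (w - sumsq y)%R *
     (C * expR (- s * w + 2 * L y))%:E))%E.
Proof.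
have a0 x : (0 <= (expR (- (z * w)))%:E * (e x)%:E)%E.
  by rewrite mule_ge0 ?lee_fin ?expR_ge0.
transitivity (\int[lebesgue_tuple n]_x \int[lebesgue_tuple q]_y
    ((expR (- (z * w)))%:E * (e x)%:E * k w y x))%E.
  apply: eq_integral => x _; rewrite ge0_integralZl//.
  exact: mk.
rewrite (fubini_tonelli (fun p : tup n * tup q =>
  (expR (- (z * w)))%:E * (e p.1)%:E * k w p.2 p.1)%E)//; last 2 first.
- apply: emeasurable_funM; last exact: mk.
  apply: measurable_funeM.
  exact: (measurableT_comp me measurable_fst).
- by move=> p; exact: mule_ge0.
apply: eq_integral => y _ /=.
have [wy|wy] := ltP (sumsq y) w; last first.
  rewrite ncgamma_kernel_eq0 ?subr_le0// mul0e; apply: integral0_eq => x _.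
  by rewrite /k ncgamma_kernel_eq0 ?subr_le0// !mul0e mule0.
transitivity (\int[lebesgue_tuple n]_x (ncgamma_kernel c dl (w - sumsq y)%R *
  (expR (2 * lincomb m y - z * w))%:E * ((e x)%:E * H w y x)))%E.
  apply: eq_integral => x _; rewrite /k.
  rewrite expRD EFinM.
  set A := ncgamma_kernel _ _ _; set D := (expR (2 * _))%:E; set B := (expR _)%:E.
  by rewrite muleACA; congr (_ * _)%E; rewrite muleC muleA.
rewrite ge0_integralZl//; last 3 first.
- by apply: emeasurable_funM => //; exact: mH.
- by move=> x _; rewrite mule_ge0 ?lee_fin.
- by rewrite mule_ge0 ?ncgamma_kernel_ge0 ?lee_fin ?expR_ge0.
rewrite HE// -muleA -EFinM mulrCA -expRD; congr (_ * (_ * expR _)%:E)%E.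
by rewrite LE /s; ring.
Qed.

(** [y] stands for the coordinates of the first vector in [q] directions, [w] for
    its squared length, and [H w y] for the law of the other vectors given these.
    As soon as the transform [HE] of [H] is log-linear in [w] and [y], the
    integral over [w] is that of a gamma kernel translated by [sumsq y], and the
    remaining integral over [y] is Gaussian. *)
Lemma integral_peel :
  (\int[leb]_w \int[lebesgue_tuple n]_x
     ((expR (- (z * w)))%:E * (e x)%:E *
      \int[lebesgue_tuple q]_y (ncgamma_kernel c dl (w - sumsq y)%R *
        (expR (2 * lincomb m y))%:E * H w y x)) =
   (C * Num.sqrt pi ^+ q * ((z - beta) `^ (- (c + q%:R / 2)) *
     expR ((dl ^+ 2 + \sum_j (m j - ka j) ^+ 2) / (z - beta))))%:E)%E.
Proof.
under eq_integral do rewrite peel1.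
have mF : measurable_fun [set: mT * tup q] (fun p => (ncgamma_kernel c dl (p.1 - sumsq p.2)%R *
   (C * expR (- s * p.1 + 2 * L p.2))%:E)%E).
  apply: emeasurable_funM.
    apply: measurable_ncgamma_kernel => //; apply: measurable_funB => //.
    exact: measurable_sumsq.
  apply/measurable_EFinP/measurable_funM => //; apply: measurable_fun_expR.
  by apply: measurable_funD; apply: measurable_funM => //; exact: mL.
rewrite (fubini_tonelli (fun p : mT * tup q => (ncgamma_kernel c dl (p.1 - sumsq p.2)%R *
   (C * expR (- s * p.1 + 2 * L p.2))%:E)%E))//; last first.
  by move=> p; rewrite mule_ge0 ?ncgamma_kernel_ge0// lee_fin mulr_ge0 ?expR_ge0.
transitivity (\int[lebesgue_tuple q]_y
   ((C * (s `^ (- c) * expR (dl ^+ 2 / s)))%:E *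
    (expR (- s * sumsq y + 2 * L y))%:E))%E.
  apply: eq_integral => y _ /=.
  pose f (r : mT) := (ncgamma_kernel c dl r *
     (C * expR (- s * (r + sumsq y) + 2 * L y))%:E)%E.
  have mf : measurable_fun [set: mT] f.
    apply: emeasurable_funM; first exact: measurable_ncgamma_kernel.
    by apply/measurable_EFinP; measR.
  have f0 r : (0 <= f r)%E.
    by rewrite mule_ge0 ?ncgamma_kernel_ge0// lee_fin mulr_ge0 ?expR_ge0.
  transitivity (\int[leb]_w f (w - sumsq y)%R)%E.
    by apply: eq_integral => w _; rewrite /f subrK.
  rewrite integral_translation//.
  transitivity (\int[leb]_r ((C * expR (- s * sumsq y + 2 * L y))%:E *
     (ncgamma_kernel c dl r * (expR (- s * r))%:E)))%E.
    apply: eq_integral => r _; rewrite /f muleCA; congr (_ * _)%E.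
    by rewrite -EFinM -mulrA -expRD; congr (_ * expR _)%:E; ring.
  rewrite ge0_integralZl//; last 3 first.
  - apply: emeasurable_funM; first exact: measurable_ncgamma_kernel.
    by apply/measurable_EFinP; measR.
  - by move=> r _; rewrite mule_ge0 ?ncgamma_kernel_ge0 ?lee_fin ?expR_ge0.
  - by rewrite lee_fin mulr_ge0 ?expR_ge0.
  rewrite integral_ncgamma_kernel// -!EFinM; congr EFin.
  by rewrite mulrAC.
rewrite ge0_integralZl//; last 2 first.
- apply/measurable_EFinP/measurable_fun_expR/measurable_funD.
    by apply: measurable_funM => //; exact: measurable_sumsq.
  by apply: measurable_funM => //; exact: mL.
- by rewrite lee_fin !mulr_ge0 ?powR_ge0 ?expR_ge0.
rewrite integral_gauss_tuple// -EFinM; congr EFin.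
rewrite -/s mulrDl expRD opprD powRD ?(gt_eqF s0) ?implybT// exprMn exprVn.
have -> : s `^ (- (q%:R / 2)) = (Num.sqrt s ^+ q)^-1.
  rewrite powRN; congr (_^-1).
  by rewrite -powR12_sqrt ?ltW// -powR_mulrn ?powR_ge0// -powRrM mulrC.
by ring.
Qed.

End integral_peel.

End Peel.

Section PeelNcgamma.
Context {R : realType}.
Notation mT := (measurableTypeR R).
Notation leb := (@lebesgue_measure R).
Notation tup n := (n.-tuple mT).

(** The recursion behind both constructions below.  Possibly after a rotation of
    the directions, the first row of [M] has entries [m M] in [q] directions and
    [dl M] in one further direction, in which the other rows, given by [N M],
    vanish ([hM]).  Given [w] and [y], the other vectors have parameter
    [K b (N M) w y]; [hK] says that its exponent is that of [N M] plus the
    log-linear term required by [integral_peel]. *)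
Section peel.
Variables (n q q0 q1 : nat) (a : R).
Variables (dl : 'M[R]_(1 + n, q0) -> R) (m : 'M[R]_(1 + n, q0) -> 'rV[R]_q)
  (N : 'M[R]_(1 + n, q0) -> 'M[R]_(n, q))
  (K : 'cV[R]_n -> 'M[R]_(n, q) -> R -> tup q -> 'M[R]_(n, q1)).
Hypothesis qa : q%:R < 2 * a.
Hypothesis mdl : forall d (X : measurableType d) (M : X -> 'M[R]_(1 + n, q0)),
  measurable_mx M -> measurable_fun [set: X] (fun w => dl (M w)).
Hypothesis mm : forall d (X : measurableType d) (M : X -> 'M[R]_(1 + n, q0)),
  measurable_mx M -> measurable_mx (fun w => m (M w)).
Hypothesis mN : forall d (X : measurableType d) (M : X -> 'M[R]_(1 + n, q0)),
  measurable_mx M -> measurable_mx (fun w => N (M w)).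
Hypothesis mK : forall d (X : measurableType d) (b : 'cV[R]_n)
    (A : X -> 'M[R]_(n, q)) (w : X -> mT) (y : X -> tup q),
  measurable_mx A -> measurable_fun [set: X] w -> measurable_fun [set: X] y ->
  measurable_mx (fun z => K b (A z) (w z) (y z)).
Hypothesis hM : forall (Z : 'M[R]_(1 + n)) (M : 'M[R]_(1 + n, q0)),
  is_posdefmx Z ->
  trace_form Z M M = (dl M ^+ 2 + \sum_j (m M ord0 j -
      ((dlsubmx Z)^T *m invmx (drsubmx Z) *m N M) ord0 j) ^+ 2) / schur_compl Z
    + trace_form (drsubmx Z) (N M) (N M).
Hypothesis hK : forall (Z : 'M[R]_n) (b : 'cV[R]_n) (A : 'M[R]_(n, q))
    (w : R) (y : tup q), is_posdefmx Z -> sumsq y < w ->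
  trace_form Z (K b A w y) (K b A w y) =
  trace_form Z A A + (trace_form Z b b * w - 2 * lincomb (fun j => (b^T *m invmx Z *m A) ord0 j) y).

Lemma has_ncgamma_peel : has_ncgamma n q1 a -> has_ncgamma (1 + n) q0 a.
Proof.
move=> IH Om Omp; have [G' g'] := IH _ (posdef_drsubmx Omp).
pose b : 'cV[R]_n := dlsubmx Om.
(* Each of the [q] directions takes one degree of freedom from the rest. *)
pose c := a - q%:R / 2.
have c0 : 0 < c by rewrite /c subr_gt0 ltr_pdivrMr// mulrC.
pose H M (w : mT) y x := G' (K b (N M) w y) x.
have H0 M w y x : (0 <= H M w y x)%E by exact: ncg_ge0 g' _ _.
have mH d (X : measurableType d) M (w : X -> mT) y x :
    measurable_mx M -> measurable_fun [set: X] w -> measurable_fun [set: X] y ->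
    measurable_fun [set: X] x ->
    measurable_fun [set: X] (fun p => H (M p) (w p) (y p) (x p)).
  by move=> mM mw my mx; apply: (ncg_meas g') => //; apply: mK => //; exact: mN.
pose k M (w : mT) y x := (ncgamma_kernel c (dl M) (w - sumsq y)%R *
  (expR (2 * lincomb (fun j => m M ord0 j) y))%:E * H M w y x)%E.
have k0 M w y x : (0 <= k M w y x)%E.
  by rewrite !mule_ge0 ?ncgamma_kernel_ge0 ?lee_fin ?expR_ge0.
have mk d (X : measurableType d) M (w : X -> mT) y x :
    measurable_mx M -> measurable_fun [set: X] w -> measurable_fun [set: X] y ->
    measurable_fun [set: X] x ->
    measurable_fun [set: X] (fun p => k (M p) (w p) (y p) (x p)).
  move=> mM mw my mx; apply: emeasurable_funM; last exact: mH.
  apply: emeasurable_funM.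
    apply: measurable_ncgamma_kernel => //; first exact: mdl.
    by apply: measurable_funB => //; exact: measurable_sumsq.
  apply/measurable_EFinP/measurable_fun_expR/measurable_funM => //.
  by apply: measurable_lincomb => // j; exact: mm.
pose I M w x := (\int[lebesgue_tuple q]_y k M w y x)%E.
have I0 M w x : (0 <= I M w x)%E by exact: integral_ge0.
have mI d (X : measurableType d) M (w : X -> mT) x :
    measurable_mx M -> measurable_fun [set: X] w -> measurable_fun [set: X] x ->
    measurable_fun [set: X] (fun p => I (M p) (w p) (x p)).
  move=> mM mw mx.
  apply: (measurable_fun_fubini_tonelli_F
    (fun z : X * tup q => k (M z.1) (w z.1) z.2 (x z.1))) => //.
  apply: mk => //; first exact: measurable_mx_comp.
    exact: (measurableT_comp mw measurable_fst).
  exact: (measurableT_comp mx measurable_fst).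
pose r := (Num.sqrt pi : R) ^+ q.
have r0 : 0 < r by rewrite exprn_gt0// sqrtr_gt0 pi_gt0.
pose cst (w : R) := r^-1 * expR (- Om ord0 ord0 * w).
have cst0 w : 0 <= cst w by rewrite mulr_ge0 ?expR_ge0// invr_ge0 ltW.
exists (fun M x => (cst (thead x))%:E * I M (thead x) [tuple of behead x])%E; split.
- by move=> M x; rewrite mule_ge0 ?lee_fin.
- move=> M x nx; rewrite [I _ _ _]integral0_eq ?mule0// => y _.
  have [x0|x0] := ltP 0 (thead x); last first.
    rewrite /k ncgamma_kernel_eq0 ?mul0e// subr_le0 (le_trans x0)//.
    exact: sumsq_ge0.
  by rewrite /k /H (ncg_supp g') ?mule0// => xb; exact/nx/orthant_consP.
- move=> d X M x mM mx; apply: emeasurable_funM.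
    apply/measurable_EFinP; rewrite /cst; apply: measurable_funM => //.
    apply: measurable_fun_expR; apply: measurable_funM => //.
    exact: measurable_thead.
  by apply: mI => //; [exact: measurable_thead|exact: measurable_tbehead].
move=> M t t0.
rewrite (@integral_slice _ n t); last 2 first.
- apply: emeasurable_funM.
    apply/measurable_EFinP; rewrite /cst; apply: measurable_funM => //.
    apply: measurable_fun_expR; apply: measurable_funM => //.
    exact: measurable_thead.
  by apply: mI; [exact: measurable_mx_cst|exact: measurable_thead|
    exact: measurable_tbehead].
- by move=> x; rewrite mule_ge0 ?lee_fin.
have Zp := posdef_add_diag Omp t0.
set Z : 'M[R]_(1 + n) := _ + _ in Zp *.
have Z'p := posdef_drsubmx Zp.
have Z'E : drsubmx Z = drsubmx Om + diag_mx (rsubmx t).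
  exact: drsubmx_add_diag.
have bE : dlsubmx Z = b by exact: dlsubmx_add_diag.
have t'0 j : 0 <= rsubmx t ord0 j by rewrite mxE t0.
set Z' := drsubmx Z in Z'p Z'E.
pose ka j := (b^T *m invmx Z' *m N M) ord0 j.
pose e (x : tup n) := expR (- tdot (rsubmx t) x).
have me : measurable_fun [set: tup n] (fun x => (e x)%:E).
  exact: measurable_exp_tdot.
have HE w y : sumsq y < w -> (\int[lebesgue_tuple n]_x ((e x)%:E * H M w y x) =
   (ncgamma_laplace a Z' (N M) * expR (trace_form Z' b b * w - 2 * lincomb ka y))%:E)%E.
  move=> yw; rewrite (ncg_lt g')// -Z'E /ncgamma_laplace hK// expRD.
  by rewrite mulrA.
have bz : trace_form Z' b b < Z ord0 ord0.
  by rewrite -subr_gt0 -bE -/(schur_compl Z) schur_compl_gt0.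
have mHM d (X : measurableType d) (w : X -> mT) y x :
    measurable_fun [set: X] w -> measurable_fun [set: X] y ->
    measurable_fun [set: X] x ->
    measurable_fun [set: X] (fun p => H M (w p) (y p) (x p)).
  by move=> *; apply: mH => //; exact: measurable_mx_cst.
have peel := @integral_peel _ q n c (dl M) (Z ord0 ord0) (trace_form Z' b b)
  (ncgamma_laplace a Z' (N M)) (fun j => m M ord0 j) ka e (H M) c0 bz
  (ncgamma_laplace_ge0 _ _ _) me (fun x => expR_ge0 _) mHM (H0 M) HE.
pose F w x := ((expR (- (Z ord0 ord0 * w)))%:E * (e x)%:E * I M w x)%E.
have F0 w x : (0 <= F w x)%E by rewrite !mule_ge0 ?lee_fin ?expR_ge0.
have mF d (X : measurableType d) (w : X -> mT) x :
    measurable_fun [set: X] w -> measurable_fun [set: X] x ->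
    measurable_fun [set: X] (fun p => F (w p) (x p)).
  move=> mw mx; apply: emeasurable_funM.
    apply: emeasurable_funM; last exact: (measurableT_comp me).
    apply/measurable_EFinP/measurable_fun_expR/measurable_funN.
    exact: measurable_funM.
  by apply: mI => //; exact: measurable_mx_cst.
transitivity (\int[leb]_w \int[lebesgue_tuple n]_x ((r^-1)%:E * F w x))%E.
  apply: eq_integral => w _; apply: eq_integral => x _.
  rewrite theadE behead_cons /F /cst !muleA -!EFinM; congr (_%:E * _)%E.
  rewrite -/e add_diag00 mulrDl opprD expRD mulNr -/(e x); ring.
transitivity (\int[leb]_w ((r^-1)%:E * \int[lebesgue_tuple n]_x F w x))%E.
  apply: eq_integral => w _; rewrite ge0_integralZl//; last 2 first.
  - exact: mF.
  - by rewrite lee_fin invr_ge0 ltW.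
rewrite ge0_integralZl//; last 3 first.
- apply: (measurable_fun_fubini_tonelli_F (fun p => F p.1 p.2)) => //.
  exact: mF.
- by move=> w _; exact: integral_ge0.
- by rewrite lee_fin invr_ge0 ltW.
rewrite peel -EFinM /ncgamma_laplace hM// det_schur// powRM; last 2 first.
- exact/ltW/schur_compl_gt0.
- exact/ltW/posdef_det.
rewrite /c subrK /schur_compl bE -/Z' -/r expRD; congr EFin.
by field; rewrite gt_eqF.
Qed.

End peel.
End PeelNcgamma.

(** * Householder reflections *)

Section Householder.
Context {R : realType}.

Definition sqnorm k (v : 'cV[R]_k) : R := (v^T *m v) ord0 ord0.

Lemma sqnormE k (v : 'cV[R]_k) : sqnorm v = \sum_j v j ord0 ^+ 2.
Proof. by rewrite /sqnorm mxE; apply: eq_bigr => j _; rewrite mxE expr2. Qed.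

Lemma sqnorm_ge0 k (v : 'cV[R]_k) : 0 <= sqnorm v.
Proof. by rewrite sqnormE; apply: sumr_ge0 => j _; exact: sqr_ge0. Qed.

Lemma sqnorm_eq0 k (v : 'cV[R]_k) : (sqnorm v == 0) = (v == 0).
Proof.
rewrite sqnormE; apply/eqP/eqP => [/psumr_eq0P h|->]; last first.
  by apply: big1 => j _; rewrite mxE expr0n.
apply/matrixP => i j; rewrite ord1 mxE.
by apply/eqP; rewrite -sqrf_eq0 h// => l _; exact: sqr_ge0.
Qed.

Lemma mul_tr_sqnorm k (v : 'cV[R]_k) : v^T *m v = (sqnorm v)%:M.
Proof. exact: mx11_scalar. Qed.

(** The reflection that negates [v].  For [v = 0], the convention [0^-1 = 0]
    makes it the identity, as needed in [reflection_swap] for [x = y]. *)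
Definition reflection k (v : 'cV[R]_k) : 'M[R]_k :=
  1%:M - (2 / sqnorm v) *: (v *m v^T).

Lemma reflection_tr k (v : 'cV[R]_k) : (reflection v)^T = reflection v.
Proof.
by rewrite /reflection linearB/= trmx1 linearZ/= trmx_mul trmxK.
Qed.

Lemma reflectionK k (v : 'cV[R]_k) : reflection v *m reflection v = 1%:M.
Proof.
have [v0|v0] := eqVneq (sqnorm v) 0.
  by rewrite /reflection v0 invr0 mulr0 scale0r subr0 mulmx1.
rewrite /reflection; set c := 2 / sqnorm v; set w := v *m v^T.
have ww : w *m w = sqnorm v *: w.
  by rewrite /w mulmxA -(mulmxA v) mul_tr_sqnorm mul_mx_scalar -scalemxAl.
rewrite mulmxBl mul1mx mulmxBr mulmx1 -scalemxAl -scalemxAr ww !scalerA.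
have -> : c * c * sqnorm v = c + c by rewrite /c; field.
by rewrite -scalerBl (_ : c - (c + c) = - c) ?scaleNr ?opprK ?subrK//; ring.
Qed.

(** [x - y] is negated and [x + y], being orthogonal to it, is fixed; hence [x]
    and [y] are exchanged. *)
Lemma reflection_swap k (x y : 'cV[R]_k) : sqnorm x = sqnorm y ->
  reflection (x - y) *m y = x.
Proof.
move=> xy; set v := x - y.
have [v0|v0] := eqVneq (sqnorm v) 0.
  move/eqP: (v0); rewrite sqnorm_eq0 /v subr_eq0 => /eqP e.
  by rewrite /reflection v0 invr0 mulr0 scale0r subr0 mul1mx.
have xyC : (x^T *m y) ord0 ord0 = (y^T *m x) ord0 ord0.
  by rewrite -[in LHS](trmxK y) -trmx_mul mxE.
have vE : sqnorm v = - (2 * (v^T *m y) ord0 ord0).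
  have BE (A B : 'M[R]_1) : (A - B) ord0 ord0 = A ord0 ord0 - B ord0 ord0.
    by rewrite !mxE.
  have vT : v^T = x^T - y^T by rewrite /v linearB.
  rewrite /sqnorm vT /v !mulmxBl !mulmxBr !BE.
  by rewrite -!/(sqnorm _) xyC xy; ring.
rewrite /reflection mulmxBl mul1mx -scalemxAl -mulmxA.
rewrite [v^T *m y]mx11_scalar mul_mx_scalar scalerA.
have -> : 2 / sqnorm v * (v^T *m y) ord0 ord0 = - 1.
  by move: v0; rewrite vE => v0; field; move: v0; rewrite oppr_eq0 mulf_eq0 negb_or => /andP[].
by rewrite scaleN1r opprK addrC subrK.
Qed.

Definition basis0 k : 'cV[R]_(1 + k) := delta_mx ord0 ord0.

Lemma sqnorm_basis0 k : sqnorm (basis0 k) = 1.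
Proof.
rewrite sqnormE (bigD1 ord0)//= mxE !eqxx expr1n big1 ?addr0// => j j0.
by rewrite mxE (negbTE j0) expr0n.
Qed.

Lemma sqnormZ k c (v : 'cV[R]_k) : sqnorm (c *: v) = c ^+ 2 * sqnorm v.
Proof.
by rewrite !sqnormE mulr_sumr; apply: eq_bigr => j _; rewrite mxE exprMn.
Qed.

(** A unit vector in the kernel of a matrix with more columns than rows, given
    by formulas that are measurable in [M].  The reflection [P] carries the first
    row to a multiple of the first basis vector, which leaves a problem with one
    row and one column less. *)
Fixpoint kernel_vector n q : 'M[R]_(n, 1 + q) -> 'cV[R]_(1 + q) :=
  match n, q return 'M[R]_(n, 1 + q) -> 'cV[R]_(1 + q) with
  | n'.+1, q'.+1 => fun M =>
    let r := (usubmx (M : 'M[R]_(1 + n', 1 + q'.+1)))^T in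
    let P := reflection (r - Num.sqrt (sqnorm r) *: basis0 q'.+1) in
    P *m col_mx (0 : 'cV[R]_1) (kernel_vector (rsubmx
      (dsubmx (M : 'M[R]_(1 + n', 1 + q'.+1)) *m P : 'M[R]_(n', 1 + (1 + q')))))
  | _, q => fun => basis0 q
  end.

Lemma kernel_vectorP n q (M : 'M[R]_(n, 1 + q)) : (n <= q)%N ->
  M *m kernel_vector M = 0 /\ sqnorm (kernel_vector M) = 1.
Proof.
elim: n q M => [|n IHn] [|q] M //= nq; try by rewrite sqnorm_basis0 [M]flatmx0 mul0mx.
set r := (usubmx _)^T; set P := reflection _; set M1 := rsubmx _.
have [ker unit] := IHn q M1 nq.
have PT : P^T = P by exact: reflection_tr.
have PP : P *m P = 1%:M by exact: reflectionK.
have Pr : r^T *m P = Num.sqrt (sqnorm r) *: (basis0 q.+1)^T.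
  have h : P *m (Num.sqrt (sqnorm r) *: basis0 q.+1) = r.
    apply: reflection_swap.
    by rewrite sqnormZ sqnorm_basis0 mulr1 sqr_sqrtr ?sqnorm_ge0.
  have {}h : P *m r = Num.sqrt (sqnorm r) *: basis0 q.+1.
    by rewrite -[in LHS]h mulmxA PP mul1mx.
  by apply: trmx_inj; rewrite trmx_mul trmxK PT h linearZ/= trmxK.
split.
  set V : 'cV[R]_(1 + q.+1) := col_mx _ _.
  have -> : M *m (P *m V) = col_mx (r^T *m P *m V)
      (dsubmx (M : 'M[R]_(1 + n, 1 + q.+1)) *m P *m V).
    by rewrite -!mulmxA -(@mul_col_mx _ 1 n) trmxK vsubmxK.
  have -> : r^T *m P *m V = 0.
    rewrite Pr -scalemxAl trmx_delta -rowE; apply/matrixP => i j.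
    by rewrite !mxE; case: splitP => // k; rewrite !mxE mulr0.
  have -> : dsubmx (M : 'M[R]_(1 + n, 1 + q.+1)) *m P *m V = 0.
    rewrite -[dsubmx _ *m P](@hsubmxK _ n 1 q.+1) (@mul_row_col _ n 1 q.+1).
    by rewrite mulmx0 add0r.
  by apply/matrixP => i j; rewrite !mxE; case: splitP => k _; rewrite mxE.
rewrite /sqnorm trmx_mul PT -mulmxA (mulmxA P) PP mul1mx.
by rewrite tr_col_mx mul_row_col trmx0 mulmx0 add0r.
Qed.

End Householder.

Section MeasurableHouseholder.
Context {R : realType} d (X : measurableType d).

Lemma measurable_sqnorm k (v : X -> 'cV[R]_k) : measurable_mx v ->
  measurable_fun [set: X] (fun w => sqnorm (v w)).
Proof.
move=> mv; apply: (measurable_mxM _ mv ord0 ord0); exact: measurable_trmx.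
Qed.

Lemma measurable_reflection k (v : X -> 'cV[R]_k) : measurable_mx v ->
  measurable_mx (fun w => reflection (v w)).
Proof.
move=> mv; apply: measurable_mxD; first exact: measurable_mx_cst.
apply: measurable_mxN; apply: measurable_mxZ.
  by measR; exact: measurable_sqnorm.
by apply: measurable_mxM => //; exact: measurable_trmx.
Qed.

Lemma measurable_kernel_vector n q (M : X -> 'M[R]_(n, 1 + q)) : measurable_mx M ->
  measurable_mx (fun w => kernel_vector (M w)).
Proof.
elim: n q M => [|n IHn] [|q] M mM; try exact: measurable_mx_cst.
rewrite /=.
have mP : measurable_mx (fun w => reflection ((usubmx (M w : 'M[R]_(1 + n, _)))^T -
    Num.sqrt (sqnorm ((usubmx (M w : 'M[R]_(1 + n, _)))^T)) *: basis0 q.+1)).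
  have mr : measurable_mx (fun w => (usubmx (M w : 'M[R]_(1 + n, _)))^T).
    by apply: measurable_trmx; exact: measurable_usubmx.
  apply: measurable_reflection; apply: measurable_mxD => //; apply: measurable_mxN.
  apply: measurable_mxZ; last exact: measurable_mx_cst.
  by measR; exact: measurable_sqnorm.
apply: measurable_mxM => //; apply: measurable_col_mx; first exact: measurable_mx_cst.
apply: IHn; apply: measurable_rsubmx; apply: measurable_mxM => //.
exact: measurable_dsubmx.
Qed.

End MeasurableHouseholder.

(** * Trading directions for vectors *)

Section Steps.
Context {R : realType}.
Notation mT := (measurableTypeR R).
Notation leb := (@lebesgue_measure R).
Notation tup n := (n.-tuple mT).

Definition row_of_tuple q (y : tup q) : 'rV[R]_q := \row_j tnth y j.

Lemma measurable_row_of_tuple d (X : measurableType d) q (y : X -> tup q) :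
  measurable_fun [set: X] y -> measurable_mx (fun w => row_of_tuple (y w)).
Proof.
move=> my i j; under eq_fun do rewrite mxE.
exact: (measurableT_comp (measurable_tnth _) my).
Qed.

Lemma row_of_tuple_sq q (y : tup q) : row_of_tuple y *m (row_of_tuple y)^T = (sumsq y)%:M.
Proof.
rewrite [LHS]mx11_scalar mx11_dot; congr (_%:M).
by apply: eq_bigr => j _; rewrite mxE.
Qed.

Lemma trace_form_outer n q (Z : 'M[R]_n) (A : 'M[R]_(n, q)) (b : 'cV[R]_n) (y : tup q) :
  trace_form Z (b *m row_of_tuple y) A = lincomb (fun j => (b^T *m invmx Z *m A) ord0 j) y.
Proof.
rewrite /trace_form trmx_mul -!mulmxA mxtrace_mulC trace_mx11 mulmxA mxE.
rewrite /lincomb; apply: eq_bigr => j _.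
by rewrite !mxE.
Qed.

Lemma trace_form_apply n q (Z : 'M[R]_n) (A : 'M[R]_(n, q)) (b : 'cV[R]_n) (y : tup q) :
  trace_form Z b (A *m (row_of_tuple y)^T) = lincomb (fun j => (b^T *m invmx Z *m A) ord0 j) y.
Proof.
rewrite /trace_form trace_mx11 mulmxA mxE; apply: eq_bigr => j _.
by rewrite !mxE.
Qed.

Lemma trace_form_outer_outer n q (Z : 'M[R]_n) (b : 'cV[R]_n) (y : tup q) :
  trace_form Z (b *m row_of_tuple y) (b *m row_of_tuple y) = trace_form Z b b * sumsq y.
Proof.
rewrite trace_form_outer mulmxA.
have -> : b^T *m invmx Z *m b = (trace_form Z b b)%:M.
  by rewrite /trace_form trace_mx11; exact: mx11_scalar.
rewrite mul_scalar_mx /lincomb /sumsq mulr_sumr; apply: eq_bigr => j _.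
by rewrite !mxE -mulrA expr2.
Qed.

(** The component of the first vector outside the [q] given directions spans a
    new direction, in which its coordinate is the square root of
    [w - sumsq y].  Given the first vector, the parameter of the others is
    shifted by [- b] times that vector. *)
Lemma has_ncgamma_new_direction n q (a : R) : q%:R < 2 * a ->
  has_ncgamma n (q + 1) a -> has_ncgamma (1 + n) q a.
Proof.
move=> qa; apply: (has_ncgamma_peel (dl := fun=> 0)
  (m := fun M : 'M[R]_(1 + n, q) => usubmx M) (N := fun M => dsubmx M)
  (K := fun b A w y => row_mx (A - b *m row_of_tuple y)
    (- Num.sqrt (w - sumsq y) *: b))) => //.
- by move=> d X M mM; exact: measurable_usubmx.
- by move=> d X M mM; exact: measurable_dsubmx.
- move=> d X b A w y mA mw my; apply: measurable_row_mx.
    apply: measurable_mxD => //; apply: measurable_mxN; apply: measurable_mxM.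
      exact: measurable_mx_cst.
    exact: measurable_row_of_tuple.
  apply: measurable_mxZ; last exact: measurable_mx_cst.
  apply: measurable_funN; apply: measurable_fun_sqrt.
  by apply: measurable_funB => //; exact: measurable_sumsq.
- move=> Z M Zp; rewrite trace_form_schur// expr0n add0r mulrC; congr (_ / _ + _).
  by apply: eq_bigr => j _; rewrite !mxE.
move=> Z b A w y Zp yw; rewrite trace_form_row_mx trace_formZl trace_formZr.
rewrite mulrA mulrNN -expr2 sqr_sqrtr ?subr_ge0 1?ltW//.
rewrite -scaleN1r trace_formDl !trace_formDr !trace_formZl !trace_formZr trace_form_outer_outer.
rewrite (trace_formC A) ?(posdef_sym Zp)// trace_form_outer; ring.
Qed.

Section shrink.
Variables (q : nat).

(** The square root of [1 - u^T u] for [u] of length at most 1: it fixes the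
    orthogonal complement of [u] and multiplies [u] by [sqrt (1 - |u|^2)]. *)
Definition shrink (u : 'rV[R]_q) : 'M[R]_q :=
  1%:M - (1 + Num.sqrt (1 - (u *m u^T) ord0 ord0))^-1 *: (u^T *m u).

Lemma shrink_tr u : (shrink u)^T = shrink u.
Proof. by rewrite /shrink linearB/= trmx1 linearZ/= trmx_mul trmxK. Qed.

Lemma shrink_sq u : (u *m u^T) ord0 ord0 <= 1 ->
  shrink u *m shrink u = 1%:M - u^T *m u.
Proof.
rewrite /shrink; set nu := (u *m u^T) ord0 ord0 => nu1.
set rho := Num.sqrt _; set c := (_^-1); set w := u^T *m u.
have rho2 : nu = 1 - rho ^+ 2 by rewrite sqr_sqrtr ?subr_ge0// subKr.
have rho0 : 1 + rho != 0 by rewrite gt_eqF// ltr_pwDl// sqrtr_ge0.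
have ww : w *m w = nu *: w.
  by rewrite /w mulmxA -(mulmxA u^T) [u *m u^T]mx11_scalar mul_mx_scalar -scalemxAl.
rewrite mulmxBl mul1mx mulmxBr mulmx1 -scalemxAl -scalemxAr ww !scalerA.
rewrite -addrA; congr (_ + _).
rewrite opprB addrCA -!scaleNr -!scalerDl -[RHS]scaleN1r; congr (_ *: _).
by rewrite rho2 /c; field.
Qed.

Lemma trace_form_shrink n (Z : 'M[R]_n) (A : 'M[R]_(n, q)) u :
  (u *m u^T) ord0 ord0 <= 1 ->
  trace_form Z (A *m shrink u) (A *m shrink u) =
  trace_form Z A A - trace_form Z (A *m u^T) (A *m u^T).
Proof.
move=> u1; rewrite /trace_form !trmx_mul shrink_tr trmxK.
rewrite !mulmxA mxtrace_mulC !mulmxA shrink_sq//.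
rewrite !mulmxBl mul1mx linearB/=; congr (_ - _).
by rewrite -!mulmxA mxtrace_mulC !mulmxA.
Qed.

Lemma measurable_shrink d (X : measurableType d) (u : X -> 'rV[R]_q) :
  measurable_mx u -> measurable_mx (fun w => shrink (u w)).
Proof.
move=> mu; apply: measurable_mxD; first exact: measurable_mx_cst.
apply: measurable_mxN; apply: measurable_mxZ.
  measR; apply: (measurable_mxM mu _ ord0 ord0); exact: measurable_trmx.
by apply: measurable_mxM => //; exact: measurable_trmx.
Qed.

End shrink.

(** Carries the first basis vector to a unit vector orthogonal to every row of
    [M] except the first. *)
Definition align n q (M : 'M[R]_(1 + n, 1 + q)) : 'M[R]_(1 + q) :=
  reflection (kernel_vector (dsubmx M) - basis0 q).

Lemma align_orthogonal n q (M : 'M[R]_(1 + n, 1 + q)) :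
  align M *m (align M)^T = 1%:M.
Proof. by rewrite reflection_tr reflectionK. Qed.

Lemma alignP n q (M : 'M[R]_(1 + n, 1 + q)) : (n <= q)%N ->
  dlsubmx (M *m align M) = 0.
Proof.
move=> nq; have [ker unit] := kernel_vectorP (dsubmx M) nq.
have ae : align M *m basis0 q = kernel_vector (dsubmx M).
  by apply: reflection_swap; rewrite unit sqnorm_basis0.
apply/matrixP => i j; rewrite ord1 !mxE.
have := congr1 (fun A : 'cV[R]_n => A i ord0) ker; rewrite -ae mulmxA.
rewrite -[X in X = _ -> _]/((dsubmx M *m align M *m delta_mx ord0 ord0) i ord0).
rewrite -colE mxE [X in X = _ -> _]mxE [X in _ = X -> _]mxE; apply: etrans.
apply: eq_bigr => k _; rewrite [dsubmx _ _ _]mxE.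
by congr (_ * align M _ _); exact: val_inj.
Qed.

Lemma measurable_align d (X : measurableType d) n q (M : X -> 'M[R]_(1 + n, 1 + q)) :
  measurable_mx M -> measurable_mx (fun w => M w *m align (M w)).
Proof.
move=> mM; apply: measurable_mxM => //; apply: measurable_reflection; apply: measurable_mxD.
  by apply: measurable_kernel_vector; exact: measurable_dsubmx.
exact: measurable_mx_cst.
Qed.

(** After the rotation [align], the mean of the first vector is the only one with
    a component [dl] in the first direction; hence all of the first vector
    outside the [q] other directions enters through its squared length only, of
    shape [a - q/2].  Given the first vector, of squared length [w], another
    vector is the sum of its component along it, which has one degree of freedom
    and whose parameter is the first block of [K], and of its component in the
    orthogonal complement, which has [2 a - 1] degrees of freedom.  If [A] lists the
    means, projecting them to this complement replaces [A A^T] by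
    [A (1 - u^T u) A^T], where [u] holds the [q] coordinates of the unit vector
    along the first one; this is the second block of [K]. *)
Lemma has_ncgamma_aligned n q (a : R) : (n <= q)%N -> q%:R < 2 * a ->
  has_ncgamma n q (a - 2^-1) -> has_ncgamma (1 + n) (1 + q) a.
Proof.
move=> nq qa IH.
have {}IH : has_ncgamma n (1 + q) a.
  have -> : a = 2^-1 + (a - 2^-1) by rewrite addrC subrK.
  by apply: has_ncgamma_conv => //; exact: has_ncgamma_half.
apply: (has_ncgamma_peel (q := q) (dl := fun M => (M *m align M) ord0 ord0)
  (m := fun M => ursubmx (M *m align M)) (N := fun M => drsubmx (M *m align M))
  (K := fun b A w y => row_mx
    ((Num.sqrt w)^-1 *: (A *m (row_of_tuple y)^T) - Num.sqrt w *: b)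
    (A *m shrink ((Num.sqrt w)^-1 *: row_of_tuple y)))) => //.
- by move=> d X M mM; exact: measurable_align.
- by move=> d X M mM; apply: measurable_rsubmx; apply: measurable_usubmx; exact: measurable_align.
- by move=> d X M mM; apply: measurable_rsubmx; apply: measurable_dsubmx; exact: measurable_align.
- move=> d X b A w y mA mw my.
  have mu : measurable_mx (fun z => (Num.sqrt (w z))^-1 *: row_of_tuple (y z)).
    by apply: measurable_mxZ; [measR|exact: measurable_row_of_tuple].
  apply: measurable_row_mx; last by apply: measurable_mxM => //; exact: measurable_shrink.
  apply: measurable_mxD.
    apply: measurable_mxZ; first by measR.
    by apply: measurable_mxM => //; apply: measurable_trmx; exact: measurable_row_of_tuple.
  by apply: measurable_mxN; apply: measurable_mxZ; [measR|exact: measurable_mx_cst].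
- move=> Z M Zp; rewrite -(trace_form_orthogonal _ _ (align_orthogonal M)).
  have := alignP M nq; move: (M *m align M) => A A0.
  rewrite trace_form_schur//.
  have dE : dsubmx A = row_mx 0 (drsubmx A).
    by rewrite -[LHS]hsubmxK -/(dlsubmx A) A0.
  rewrite dE trace_form_row_mx (_ : trace_form _ 0 0 = 0) ?add0r; last first.
    by rewrite /trace_form mulmx0 mxtrace0.
  rewrite mulrC; congr (_ / _ + _).
  rewrite big_ord_recl mul_mx_row mulmx0; congr (_ + _).
    rewrite !mxE; case: splitP => // k _; rewrite mxE subr0.
    by congr (A _ _ ^+ 2); exact: val_inj.
  apply: eq_bigr => j _; rewrite !mxE; case: splitP => [k|k] /=.
    by rewrite ord1 /bump.
  rewrite /bump leq0n !add1n => -[/val_inj ->]; rewrite !mxE.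
  by congr ((A _ _ - _) ^+ 2); exact: val_inj.
move=> Z b A w y Zp yw.
have w0 : 0 < w by exact: le_lt_trans (sumsq_ge0 _) yw.
have rw0 : 0 < Num.sqrt w by rewrite sqrtr_gt0.
set u := _ *: row_of_tuple y.
have u1 : (u *m u^T) ord0 ord0 <= 1.
  rewrite /u linearZ/= -scalemxAl -scalemxAr row_of_tuple_sq !mxE mulr1n mulrA -invfM -expr2.
  by rewrite sqr_sqrtr ?(ltW w0)// mulrC ler_pdivrMr// mul1r ltW.
have uT : u^T = (Num.sqrt w)^-1 *: (row_of_tuple y)^T by rewrite /u linearZ.
rewrite trace_form_row_mx trace_form_shrink// uT -!scalemxAr.
rewrite -scaleNr trace_formDl !trace_formDr !trace_formZl !trace_formZr.
rewrite (trace_formC _ b) ?(posdef_sym Zp)// (trace_form_apply Z A b).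
have -> : trace_form Z b b * w = trace_form Z b b * Num.sqrt w ^+ 2.
  by rewrite sqr_sqrtr// ltW.
by field; rewrite gt_eqF.
Qed.

(** [2 a - q] does not change along [has_ncgamma_aligned]. *)
Lemma has_ncgamma_few_rows n q (a : R) : (n <= q)%N -> (0 < q)%N -> q%:R - 1 < 2 * a ->
  has_ncgamma n q a.
Proof.
elim: n q a => [|n IHn] [|q] a //= nq _ qa; first exact: has_ncgamma0.
have qa' : q%:R < 2 * a by rewrite -[q.+1]addn1 natrD addrK in qa.
apply: has_ncgamma_aligned => //; case: q nq qa qa' => [|q] nq qa qa'.
  by move: nq; rewrite ltnS leqn0 => /eqP ->; exact: has_ncgamma0.
apply: IHn => //; rewrite mulrBr mulfV// ltrD2r//.
Qed.

Lemma has_ncgamma_trade_directions n q k (a : R) : (k <= q)%N -> q%:R - 1 < 2 * a ->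
  has_ncgamma n q a -> has_ncgamma (k + n) (q - k) a.
Proof.
move=> + qa h; elim: k => [|k IHk] kq; first by rewrite subn0.
apply: has_ncgamma_new_direction.
  apply: le_lt_trans qa; rewrite lerBrDr natr1 ler_nat.
  by rewrite subnSK// leq_subr.
by rewrite addn1 subnSK//; apply: IHk; exact: ltnW.
Qed.

(** With [q] directions at the start, both rules require [q - 1 < 2 a], and the
    second one at most [q] rows; [q = k + 1] is the least value for which [q] rows
    and [q] traded directions reach [p]. *)
Lemma has_ncgamma_large p (a : R) : (0 < p)%N ->
  ((p - 1) %/ 2)%N%:R < 2 * a -> has_ncgamma p 0 a.
Proof.
move=> p0; set k := ((p - 1) %/ 2)%N => ka.
have kp : (k.+1 <= p)%N by rewrite /k; lia.
have nq : (p - k.+1 <= k.+1)%N by rewrite /k; lia.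
have qa : k.+1%:R - 1 < 2 * a by rewrite -natr1 addrK.
have := has_ncgamma_trade_directions (leqnn k.+1) qa (has_ncgamma_few_rows nq (ltn0Sn k) qa).
by rewrite subnn subnKC.
Qed.

(** The convolution of [n] laws with one degree of freedom each. *)
Lemma has_ncgamma_integer p n : (1 <= n)%N ->
  exists q, has_ncgamma p q (n%:R / 2 : R).
Proof.
elim: n => // -[_ _|n IHn _].
  by exists 1%N; rewrite mul1r; exact: has_ncgamma_half.
have [q hq] := IHn isT; exists (1 + q)%N.
have -> : n.+2%:R / 2 = 2^-1 + n.+1%:R / 2 :> R.
  by rewrite -[n.+2%:R]natr1 mulrDl mul1r addrC.
by apply: has_ncgamma_conv => //; exact: has_ncgamma_half.
Qed.

(** * Existence of the density *)

(** At [M = 0] and up to the factor [det Sigma^-a], the transform is the required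
    one; at [t = 0] it is the total mass 1, so the extended-real valued density
    is finite almost everywhere and may be replaced by its finite part. *)
Lemma gamma_pdf_of_ncgamma p q (a : R) (Sigma : 'M[R]_p) :
  is_posdefmx Sigma -> has_ncgamma p q a ->
  exists g : tup p -> R, is_gamma_pdf a Sigma g.
Proof.
move=> Sp h; have [G G'] := h _ (posdef_inv Sp).
pose D := \det (invmx Sigma) `^ a.
have uS := posdef_unit Sp.
have dS := posdef_det Sp.
have D0 : 0 < D by rewrite powR_gt0// posdef_det//; exact: posdef_inv.
pose F (x : tup p) := (D%:E * G 0%R x)%E.
have F0 x : (0 <= F x)%E.
  by rewrite mule_ge0 ?lee_fin ?(ltW D0)//; exact: ncg_ge0 G' _ _.
have mG : measurable_fun [set: tup p] (G 0).
  by apply: (ncg_meas G'); [exact: measurable_mx_cst|exact: measurable_id].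
have mF : measurable_fun [set: tup p] F by exact: measurable_funeM.
have lt_F (t : 'rV[R]_p) : (forall j, 0 <= t ord0 j) ->
    (\int[lebesgue_tuple p]_x ((expR (- tdot t x))%:E * F x) =
     (\det (1%:M + Sigma *m diag_mx t) `^ (- a))%:E)%E.
  move=> t0.
  transitivity (\int[lebesgue_tuple p]_x (D%:E * ((expR (- tdot t x))%:E * G 0%R x)))%E.
    by apply: eq_integral => x _; rewrite /F muleCA.
  rewrite ge0_integralZl//; last 3 first.
  - by apply: emeasurable_funM => //; exact: measurable_exp_tdot.
  - by move=> x _; rewrite mule_ge0 ?lee_fin ?expR_ge0//; exact: ncg_ge0 G' _ _.
  - by rewrite lee_fin ltW.
  rewrite (ncg_lt G')// -EFinM /ncgamma_laplace /trace_form mulmx0 mxtrace0 expR0 mulr1.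
  congr EFin; rewrite /D.
  have Zd : 0 < \det (invmx Sigma + diag_mx t).
    exact/posdef_det/posdef_add_diag/t0/posdef_inv.
  have -> : 1%:M + Sigma *m diag_mx t = Sigma *m (invmx Sigma + diag_mx t).
    by rewrite mulmxDr mulmxV.
  rewrite det_mulmx powRM ?ltW// det_inv; congr (_ * _).
  by rewrite -powR_inv1 ?ltW// -powRrM mulN1r.
have intF : (\int[lebesgue_tuple p]_x F x = 1)%E.
  transitivity (\int[lebesgue_tuple p]_x ((expR (- tdot 0%R x))%:E * F x))%E.
    apply: eq_integral => x _; rewrite /tdot big1 ?oppr0 ?expR0 ?mul1e// => j _.
    by rewrite mxE mul0r.
  rewrite lt_F; last by move=> j; rewrite mxE.
  by rewrite linear0 mulmx0 addr0 det1 powR1.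
have Ffin : {ae lebesgue_tuple p, forall x, F x \is a fin_num}.
  have : (lebesgue_tuple p).-integrable [set: tup p] F.
    apply/integrableP; split => //.
    under eq_integral do rewrite gee0_abs//.
    by rewrite intF ltry.
  move/(integrable_ae measurableT).
  by apply: filterS => x; apply.
pose g x := fine (F x).
have mo : measurable (@orthant R p).
  rewrite (_ : @orthant R p = \bigcap_(j in [set: 'I_p])
     ((@tnth p mT)^~ j @^-1` [set` `]0%R, +oo[])).
    apply: fin_bigcap_measurable => // j _.
    by rewrite -[X in measurable X]setTI; apply: measurable_tnth.
  apply/seteqP; split => x /= xo j; first by rewrite /= in_itv/= andbT.
  by have := xo j I; rewrite /= in_itv/= andbT.
have mg : measurable_fun [set: tup p] g by exact: measurableT_comp.
have intg (e : tup p -> R) : measurable_fun [set: tup p] e -> (forall x, 0 <= e x) ->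
    (\int[lebesgue_tuple p]_(x in @orthant R p) (e x * g x)%:E =
     \int[lebesgue_tuple p]_x ((e x)%:E * F x))%E.
  move=> me basis0.
  have -> : (\int[lebesgue_tuple p]_x ((e x)%:E * F x) =
      \int[lebesgue_tuple p]_(x in @orthant R p) ((e x)%:E * F x))%E.
    rewrite [RHS]integral_mkcond; apply: eq_integral => x _; rewrite patchE.
    by case: ifPn => // /negP; rewrite inE => xo; rewrite /F (ncg_supp G')// !mule0.
  apply: ge0_ae_eq_integral => //.
  - by apply/measurable_EFinP; apply: measurable_funTS; exact: measurable_funM.
  - apply: measurable_funTS; apply: emeasurable_funM => //.
    exact/measurable_EFinP.
  - by move=> x _; rewrite lee_fin mulr_ge0// fine_ge0.
  - by move=> x _; rewrite mule_ge0 ?lee_fin.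
  by apply: filterS Ffin => x Fx _; rewrite EFinM fineK.
exists g; split.
  split.
  - exact: measurable_funTS.
  - by move=> x _; rewrite fine_ge0.
  - rewrite -intF; have := intg (fun=> 1) (measurable_cst _) (fun=> ler01).
    under eq_integral do rewrite mul1r.
    by under [X in _ = X]eq_integral do rewrite mul1e.
move=> t t0; rewrite /laplace intg ?lt_F//.
by apply/measurable_EFinP; exact: measurable_exp_tdot.
Qed.

End Steps.

Unset Implicit Arguments.

Theorem theorem2 (R : realType) (p : nat) (p_ge1 : (1 <= p)%N)
    (Sigma : 'M[R]_p) (Sigma_posdef : is_posdefmx Sigma)
    (alpha : R) (alpha_gt0 : 0 < alpha)
    (alpha_range : (exists2 n : nat, (1 <= n)%N & 2 * alpha = n%:R) \/
                   ((p - 1) %/ 2)%N%:R < 2 * alpha) :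
  exists g : p.-tuple (measurableTypeR R) -> R, is_gamma_pdf alpha Sigma g.
Proof.
case: alpha_range => [[n n1 an]|pa].
  have [q] := @has_ncgamma_integer R p n n1.
  rewrite -an mulrAC mulfV ?mul1r// => h.
  exact: gamma_pdf_of_ncgamma h.
exact: gamma_pdf_of_ncgamma (has_ncgamma_large p_ge1 pa).
Qed.
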